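(* Let $z$ be the element of $\mathcal{K}$ defined as $(z_s)_{s\in S}$, where $z_s$ is a local coordinate at $s$. Then for some $i\in 1+\hbar\bigoplus_{s,t\in S}\mathbb{C}((z_s,w_t))[[\hbar]]$, we have $$z-q^{-\partial}w=i\cdot\bigl[\,z-w+(z-w)\,G\,\psi(\hbar,(\partial^j\otimes 1)\gamma)\,\bigr].$$
   Context: $X$ is a smooth, connected, compact complex curve, $\omega$ a nonzero meromorphic differential on $X$, and $S$ a finite set of points of $X$ containing all zeros and poles of $\omega$. $\mathcal{K}_s$ is the local field at $s\in S$ and $\mathcal{K}=\bigoplus_{s\in S}\mathcal{K}_s$, with bilinear form $\langle f,g\rangle_{\mathcal{K}}=\sum_{s\in S}\mathrm{res}_s(fg\omega)$ and derivation $\partial f=df/\omega$. $R\subset\mathcal{K}$ is the ring of meromorphic functions on $X$ regular outside $S$, embedded by Laurent expansion; it is maximal isotropic. $\Lambda$ is a Lagrangian (maximal isotropic) complement of $R$ in $\mathcal{K}$, commensurable with $\bigoplus_{s\in S}\mathcal{O}_s$, where $\mathcal{O}_s$ is the completed local ring at $s$. $(e^i)_{i\ge0}$ and $(e_i)_{i\ge0}$ are dual bases of $R$ and $\Lambda$, with $e_i\to0$ as $i\to\infty$. The Green kernel is $G=\sum_i e^i\otimes e_i\in R\hat\otimes\Lambda$; the first tensor factor corresponds to the variable $z$, the second to the variable $w$ (a second copy of $z$, with components $w_t$, $t\in S$), so that $z-w$ stands for $z\otimes1-1\otimes z$. One sets $\gamma=(\partial\otimes1)G-G^2$, which belongs to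 $R\otimes R$. Moreover, for $f\in\mathcal{K}$ the product $(f\otimes1-1\otimes f)G$ belongs to $\bigoplus_{s,t\in S}\mathbb{C}((z_s,w_t))$, where $\mathbb{C}((z_s,w_t))=\mathbb{C}[[z_s,w_t]][z_s^{-1},w_t^{-1}]$. $\hbar$ is a formal variable and $q=e^{\hbar}$, so $q^{-\partial}=\sum_{k\ge0}\frac{(-\hbar)^k}{k!}\partial^k$; in $q^{-\partial}w$ the derivation acts on $w$ as an element of $\mathcal{K}$. For free variables $(\gamma_j)_{j\ge0}$ and $D=\sum_{j\ge0}\gamma_{j+1}\,\partial/\partial\gamma_j$, $\psi\in\hbar\,\mathbb{C}[\gamma_j][[\hbar]]$ is the solution of $\frac{\partial\psi}{\partial\hbar}=D\psi-1-\gamma_0\psi^2$; $\psi(\hbar,(\partial^j\otimes1)\gamma)\in\hbar(R\otimes R)[[\hbar]]$ is obtained by substituting $\gamma_j=(\partial^j\otimes1)\gamma$ for all $j\ge0$.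
   Formalization: The dual bases are normalised by ⟨e^i,e_j⟩ = −δ_ij (with +δ_ij, γ has a double pole on the diagonal and the identity fails), and the identity is claimed only for components (s,t) with s=t or with z_s(s) ≠ z_t(t), since it fails for the others. *)

(* Defs.v *)
From HB Require Import structures.
From mathcomp Require Import all_boot all_order all_algebra.
From mathcomp Require Import finmap complex monalg zify ring.
From mathcomp Require Import all_classical all_reals all_analysis.

Set Implicit Arguments.
Unset Strict Implicit.
Unset Printing Implicit Defensive.

Import Order.TTheory GRing.Theory Num.Theory.
Import numFieldNormedType.Exports.

Local Open Scope classical_set_scope.
Local Open Scope ring_scope.

Record fps (A : Type) := Fps { fcoef :> nat -> A }.

HB.instance Definition _ (A : Type) := gen_eqMixin (fps A).
HB.instance Definition _ (A : Type) := gen_choiceMixin (fps A).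

Lemma fpsP (A : Type) (f g : fps A) : f =1 g -> f = g.
Proof. by case: f g => [f] [g] /= /funext ->. Qed.

Section FpsRing.
Variable A : comNzRingType.
Implicit Types f g : fps A.

Definition fps_zero : fps A := Fps (fun=> 0).
Definition fps_opp f : fps A := Fps (fun n => - f n).
Definition fps_add f g : fps A := Fps (fun n => f n + g n).
Definition fpsC (a : A) : fps A := Fps (fun n => if n is 0%N then a else 0).
Definition fps_mul f g : fps A :=
  Fps (fun n => \sum_(i < n.+1) f i * g (n - i)%N).

Fact fps_addA : associative fps_add.
Proof. by move=> f g h; apply: fpsP => n /=; rewrite addrA. Qed.
Fact fps_addC : commutative fps_add.
Proof. by move=> f g; apply: fpsP => n /=; rewrite addrC. Qed.
Fact fps_add0 : left_id fps_zero fps_add.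
Proof. by move=> f; apply: fpsP => n /=; rewrite add0r. Qed.
Fact fps_addN : left_inverse fps_zero fps_opp fps_add.
Proof. by move=> f; apply: fpsP => n /=; rewrite addNr. Qed.

HB.instance Definition _ :=
  GRing.isZmodule.Build (fps A) fps_addA fps_addC fps_add0 fps_addN.

Let trunc n f : {poly A} := \poly_(i < n.+1) f i.

Let fps_mulE n f g m : (m <= n)%N -> fps_mul f g m = (trunc n f * trunc n g)`_m.
Proof.
move=> mn; rewrite coefM; apply: eq_bigr => i _; rewrite !coef_poly.
by rewrite !ltnS (leq_trans _ mn) ?(leq_trans (leq_subr _ _) mn) // -ltnS.
Qed.

Fact fps_mulA : associative fps_mul.
Proof.
move=> f g h; apply: fpsP => n.
have E (p q : fps A) (P Q : {poly A}) :
    (forall m, (m <= n)%N -> p m = P`_m) ->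
    (forall m, (m <= n)%N -> q m = Q`_m) -> fps_mul p q n = (P * Q)`_n.
  move=> pP qQ; rewrite coefM; apply: eq_bigr => i _.
  by rewrite pP ?qQ ?leq_subr // -ltnS.
have T (p : fps A) m : (m <= n)%N -> p m = (trunc n p)`_m by rewrite coef_poly ltnS => ->.
rewrite (E _ _ (trunc n f) (trunc n g * trunc n h)); first last.
- by move=> m mn; exact: fps_mulE.
- by move=> m mn; exact: T.
rewrite (E _ _ (trunc n f * trunc n g) (trunc n h)) ?mulrA //.
- by move=> m mn; exact: fps_mulE.
- by move=> m mn; exact: T.
Qed.

Fact fps_mulC : commutative fps_mul.
Proof.
by move=> f g; apply: fpsP => n; rewrite !(@fps_mulE n) // mulrC.
Qed.

Fact fps_mul1 : left_id (fpsC 1) fps_mul.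
Proof.
move=> f; apply: fpsP => n /=; rewrite big_ord_recl /= mul1r subn0.
by rewrite big1 ?addr0 // => i _; rewrite /bump /= mul0r.
Qed.

Fact fps_mulD : left_distributive fps_mul fps_add.
Proof.
move=> f g h; apply: fpsP => n /=; rewrite -big_split /=.
by apply: eq_bigr => i _; rewrite mulrDl.
Qed.

Fact fps_one_neq0 : fpsC 1 != 0.
Proof.
by apply/eqP => /(congr1 (fun f : fps A => f 0%N)) /= /eqP; rewrite oner_eq0.
Qed.

HB.instance Definition _ := GRing.Zmodule_isComNzRing.Build (fps A)
  fps_mulA fps_mulC fps_mul1 fps_mulD fps_one_neq0.

Definition fps_deriv f : fps A := Fps (fun n => f n.+1 *+ n.+1).

End FpsRing.

Definition fps_map (A B : Type) (phi : A -> B) (f : fps A) : fps B :=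
  Fps (phi \o f).

Definition bounded_below (A : nmodType) (f : int -> A) :=
  exists N : nat, forall n : int, n < - N%:Z -> f n = 0.

Record laurent (A : nmodType) := Laurent {
  lcoef :> int -> A;
  lcoef_bounded : bounded_below lcoef }.

HB.instance Definition _ (A : nmodType) := gen_eqMixin (laurent A).
HB.instance Definition _ (A : nmodType) := gen_choiceMixin (laurent A).

Lemma laurentP (A : nmodType) (f g : laurent A) : f =1 g -> f = g.
Proof.
by case: f g => [f fb] [g gb] /= /funext fg; subst g; congr Laurent.
Qed.

Section LaurentRing.
Variable A : comNzRingType.
Implicit Types f g h : laurent A.

Let vanish (N : nat) (f : int -> A) := forall n : int, n < - N%:Z -> f n = 0.

Let vanishW N M f : (N <= M)%N -> vanish N f -> vanish M f.
Proof.
by move=> NM fN n nM; apply: fN; rewrite (lt_le_trans nM)// lerN2 lez_nat.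
Qed.

Let vanish3 f g h : exists N, [/\ vanish N f, vanish N g & vanish N h].
Proof.
have [[Nf fN] [Ng gN] [Nh hN]] := And3 (lcoef_bounded f) (lcoef_bounded g)
  (lcoef_bounded h).
by exists (Nf + Ng + Nh)%N; split;
  [apply: vanishW fN|apply: vanishW gN|apply: vanishW hN];
  rewrite ?leq_addl // -?addnA ?leq_addr // addnCA leq_addr.
Qed.

Let shift (N : nat) (f : int -> A) : fps A := Fps (fun i => f (i%:Z - N%:Z)).

Let shift_inj N f g : vanish N f -> vanish N g -> shift N f = shift N g -> f = g.
Proof.
move=> fN gN fg; apply: laurentP => n.
have [nN|] := ltP n (- N%:Z); first by rewrite fN // gN.
rewrite -subr_ge0 opprK => nN.
have := congr1 (fun p : fps A => p (absz (n + N%:Z))) fg => /=.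
by rewrite gez0_abs // addrK.
Qed.

Fact lzero_bounded : bounded_below (fun=> 0 : A).
Proof. by exists 0%N. Qed.
Definition lzero : laurent A := Laurent lzero_bounded.

Fact lopp_bounded f : bounded_below (fun n => - f n).
Proof.
by case: (lcoef_bounded f) => N fN; exists N => n /fN ->; rewrite oppr0.
Qed.
Definition lopp f : laurent A := Laurent (lopp_bounded f).

Fact ladd_bounded f g : bounded_below (fun n => f n + g n).
Proof.
have [N [fN gN _]] := vanish3 f g f.
by exists N => n nN; rewrite fN // gN // addr0.
Qed.
Definition ladd f g : laurent A := Laurent (ladd_bounded f g).

Definition lmul_coef f g (n : int) : A :=
  \sum_(k \in [set: int]) f k * g (n - k).

Let lmul_coefE N M f g (i : nat) : vanish N f -> vanish M g ->
  lmul_coef f g (i%:Z - (N + M)%:Z) = fps_mul (shift N f) (shift M g) i.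
Proof.
move=> fN gM; pose r := [seq j%:Z - N%:Z | j <- iota 0 i.+1].
rewrite /lmul_coef (fsbigE r).
- rewrite big_map -[iota 0 i.+1]/(index_iota 0 i.+1) big_mkord.
  apply: eq_big => [j|j _]; first by rewrite in_setT.
  rewrite /=; congr (_ * _); congr (lcoef g _). rewrite -subzn -1?ltnS // PoszD.
  by ring.
- by rewrite map_inj_uniq ?iota_uniq // => a b /addIr [].
- by [].
- move=> k _ kr; have [kN|Nk] := ltP k (- N%:Z); first by rewrite fN ?mul0r.
  rewrite gM ?mulr0 //; rewrite ltNge; apply/negP => le.
  move/negP: kr; apply; apply/mapP; exists (absz (k + N%:Z)).
    by rewrite mem_iota; clear -Nk le; lia.
  by clear -Nk; lia.
Qed.

Let lmul_vanish N M f g : vanish N f -> vanish M g ->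
  vanish (N + M) (lmul_coef f g).
Proof.
move=> fN gM n nNM; rewrite /lmul_coef fsbig1 // => k _.
have [kN|Nk] := ltP k (- N%:Z); first by rewrite fN ?mul0r.
by rewrite gM ?mulr0 //; clear -Nk nNM; lia.
Qed.

Fact lmul_bounded f g : bounded_below (lmul_coef f g).
Proof.
have [N [fN gN _]] := vanish3 f g f.
by exists (N + N)%N; exact: lmul_vanish.
Qed.
Definition lmul f g : laurent A := Laurent (lmul_bounded f g).

Let shift_mul N M f g : vanish N f -> vanish M g ->
  shift (N + M) (lmul f g) = shift N f * shift M g.
Proof. by move=> fN gM; apply: fpsP => i; exact: lmul_coefE. Qed.

Fact lC_bounded (a : A) : bounded_below (fun n : int => if n == 0 then a else 0).
Proof. by exists 0%N => n n0; rewrite lt_eqF. Qed.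
Definition lC (a : A) : laurent A := Laurent (lC_bounded a).

Fact laddA : associative ladd.
Proof. by move=> f g h; apply: laurentP => n /=; rewrite addrA. Qed.
Fact laddC : commutative ladd.
Proof. by move=> f g; apply: laurentP => n /=; rewrite addrC. Qed.
Fact ladd0 : left_id lzero ladd.
Proof. by move=> f; apply: laurentP => n /=; rewrite add0r. Qed.
Fact laddN : left_inverse lzero lopp ladd.
Proof. by move=> f; apply: laurentP => n /=; rewrite addNr. Qed.

HB.instance Definition _ :=
  GRing.isZmodule.Build (laurent A) laddA laddC ladd0 laddN.

Fact lmulA : associative lmul.
Proof.
move=> f g h; have [N [fN gN hN]] := vanish3 f g h.
have fgN : vanish (N + N) (lmul f g) by exact: lmul_vanish.
have ghN : vanish (N + N) (lmul g h) by exact: lmul_vanish.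
apply: (@shift_inj (N + (N + N))%N); first exact: lmul_vanish.
  by rewrite addnA; exact: lmul_vanish.
by rewrite shift_mul // [in RHS]addnA !shift_mul // mulrA.
Qed.

Fact lmulC : commutative lmul.
Proof.
move=> f g; have [N [fN gN _]] := vanish3 f g f.
apply: (@shift_inj (N + N)%N); [exact: lmul_vanish..|].
by rewrite !shift_mul // mulrC.
Qed.

Fact lmul1 : left_id (lC 1) lmul.
Proof.
move=> f; have [N [fN _ _]] := vanish3 f f f.
have l1 : vanish 0 (lC 1) by move=> n n0 /=; rewrite lt_eqF.
apply: (@shift_inj (0 + N)%N) => //; first exact: lmul_vanish.
rewrite shift_mul //; have -> : shift 0 (lC 1) = 1.
  by apply: fpsP => -[|n].
by rewrite mul1r.
Qed.

Fact lmulD : left_distributive lmul ladd.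
Proof.
move=> f g h; have [N [fN gN hN]] := vanish3 f g h.
have fgN : vanish N (ladd f g) by move=> n nN /=; rewrite fN // gN // addr0.
apply: (@shift_inj (N + N)%N); first exact: lmul_vanish.
  by move=> n nN /=; rewrite !(@lmul_vanish N N) // addr0.
have shiftD M (p q : laurent A) : shift M (ladd p q) = shift M p + shift M q.
  exact: fpsP.
by rewrite shiftD !shift_mul // shiftD mulrDl.
Qed.

Fact lone_neq0 : lC 1 != 0.
Proof.
by apply/eqP => /(congr1 (fun f : laurent A => f 0)) /= /eqP; rewrite oner_eq0.
Qed.

HB.instance Definition _ := GRing.Zmodule_isComNzRing.Build (laurent A)
  lmulA lmulC lmul1 lmulD lone_neq0.

Fact lscale_bounded (a : A) f : bounded_below (fun n => a * f n).
Proof.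
by case: (lcoef_bounded f) => N fN; exists N => n /fN ->; rewrite mulr0.
Qed.
Definition lscale (a : A) f : laurent A := Laurent (lscale_bounded a f).

Fact lscaleA a b f : lscale a (lscale b f) = lscale (a * b) f.
Proof. by apply: laurentP => n /=; rewrite mulrA. Qed.
Fact lscale1 : left_id 1 lscale.
Proof. by move=> f; apply: laurentP => n /=; rewrite mul1r. Qed.
Fact lscaleDr : right_distributive lscale +%R.
Proof. by move=> a f g; apply: laurentP => n /=; rewrite mulrDr. Qed.
Fact lscaleDl f : {morph lscale^~ f : a b / a + b}.
Proof. by move=> a b; apply: laurentP => n /=; rewrite mulrDl. Qed.

HB.instance Definition _ := GRing.Zmodule_isLmodule.Build A (laurent A)
  lscaleA lscale1 lscaleDr lscaleDl.

(* Inverses are chosen classically; over a field every nonzero series is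
   invertible. *)
Definition lunit : pred (laurent A) := fun f => `[< exists g, g * f = 1 >].
Definition linv f : laurent A :=
  if pselect (exists g, g * f = 1) is left e then projT1 (cid e) else f.

Fact lmulVr : {in lunit, left_inverse 1 linv *%R}.
Proof.
move=> f /asboolP ef; rewrite /linv; case: pselect => // e.
by case: (cid e).
Qed.
Fact lunitP f g : g * f = 1 -> lunit f.
Proof. by move=> gf; apply/asboolP; exists g. Qed.
Fact linv_out : {in [predC lunit], linv =1 id}.
Proof. by move=> f /asboolPn nf; rewrite /linv; case: pselect. Qed.

HB.instance Definition _ := GRing.ComNzRing_hasMulInverse.Build (laurent A)
  lmulVr lunitP linv_out.

Fact lderiv_bounded f : bounded_below (fun n => f (n + 1) *~ (n + 1)).
Proof.
case: (lcoef_bounded f) => N fN; exists N.+1 => n nN.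
by rewrite fN ?mul0rz //; clear -nN; lia.
Qed.
Definition lderiv f : laurent A := Laurent (lderiv_bounded f).

Fact lvar_bounded : bounded_below (fun n : int => (n == 1)%:R : A).
Proof. by exists 0%N => n n0; rewrite lt_eqF // (lt_trans n0). Qed.
Definition lvar : laurent A := Laurent lvar_bounded.

End LaurentRing.

Definition laurent_of (A : comNzRingType) (f : int -> A) : laurent A :=
  if pselect (bounded_below f) is left fb then Laurent fb else 0.

Definition lmap (A B : comNzRingType) (phi : A -> B) (f : laurent A) : laurent B :=
  laurent_of (phi \o f).

Section LocalField.
Variables (k : fieldType) (S : finType).

Notation K := {ffun S -> laurent k}.

(* [h s] is the expansion of omega at [s]: omega = h_s(t_s) dt_s. *)
Definition respairing (h : S -> laurent k) (f g : K) : k :=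
  \sum_(s : S) (f s * g s * h s) (- 1).

Definition localder (h : S -> laurent k) (f : K) : K :=
  [ffun s => lderiv (f s) / h s].

Definition linear_subspace (V : set K) :=
  V 0 /\ forall (c : k) u v, V u -> V v -> V (c *: u + v).

Definition isotropic h (V : set K) := forall u v, V u -> V v -> respairing h u v = 0.

Definition maximal_isotropic h (V : set K) :=
  [/\ linear_subspace V, isotropic h V &
      forall W : set K, linear_subspace W -> isotropic h W -> V `<=` W -> W = V].

Definition complementary (V W : set K) :=
  V `&` W = [set 0] /\ forall f, exists u v, [/\ V u, W v & f = u + v].

Definition finite_codim (V W : set K) :=
  exists (n : nat) (b : 'I_n -> K), (forall j, V (b j)) /\
    forall u, V u -> exists c : 'I_n -> k, W (u - \sum_j c j *: b j).

Definition commensurable (V W : set K) :=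
  finite_codim V (V `&` W) /\ finite_codim W (V `&` W).

Definition integers : set K := [set f : K | forall s (n : int), n < 0 -> f s n = 0].

Definition adic_cvg (u : nat -> K) (l : K) :=
  forall N : int, exists m0 : nat, forall m, (m0 <= m)%N ->
    forall s (n : int), n < N -> (l - u m) s n = 0.

Definition is_basis (V : set K) (b : nat -> K) :=
  [/\ forall j, V (b j),
      forall n (c : nat -> k), \sum_(j < n) c j *: b j = 0 ->
        forall j, (j < n)%N -> c j = 0 &
      forall v, V v -> exists n (c : nat -> k), v = \sum_(j < n) c j *: b j].

Definition is_adic_basis (V : set K) (b : nat -> K) :=
  (forall j, V (b j)) /\
  forall v, V v -> exists! c : nat -> k, adic_cvg (fun m => \sum_(j < m) c j *: b j) v.

(* The sign: with <e^i, e_j> = delta_ij, pairing \sum_i e^i(z) e_i(w) against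
   r in R in the variable w returns r(z), so by the residue theorem G is
   1/(z - w) + regular near the diagonal in a coordinate with omega = dz, and
   (\partial \otimes 1)G - G^2 has the polar part -2/(z - w)^2.  It is regular,
   i.e. belongs to R \otimes R, for the opposite sign. *)
Definition dual_families h (e' e : nat -> K) :=
  forall i j, respairing h (e' i) (e j) = - (i == j)%:R.

(* The component (s, t) of a kernel is an element of k((z_s))((w_t)), i.e. a
   Laurent series in w_t whose coefficients are Laurent series in z_s.  This ring
   contains k((z_s, w_t)) and the components of the completed tensor product of
   R and Lambda. *)
Notation kernel := (laurent (laurent k)).

Definition tensl (f : laurent k) : kernel := lC f.
Definition tensr (f : laurent k) : kernel := lmap (@lC k) f.

(* k((z_s, w_t)) = k[[z_s, w_t]][z_s^-1, w_t^-1], as a subset of k((z_s))((w_t)) *)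
Definition in_klaurent2 (F : kernel) :=
  exists N : int, forall m n : int, m < N \/ n < N -> F n m = 0.

(* For each n the sum is finite when e_j -> 0. *)
Definition green (e' e : nat -> K) (s t : S) : kernel :=
  laurent_of (fun n => \sum_(j \in [set: nat]) e j t n *: e' j s).

(* \partial \otimes 1 *)
Definition derl (h : S -> laurent k) (s : S) (F : kernel) : kernel :=
  lmap (fun a => lderiv a / h s) F.

Definition gamma_kernel h (e' e : nat -> K) (s t : S) : kernel :=
  derl h s (green e' e s t) - green e' e s t ^+ 2.

(* q^{-\partial} f, with q = e^hbar *)
Definition qder h (f : K) (t : S) : fps (laurent k) :=
  Fps (fun n => ((- 1) ^+ n / n`!%:R) *: iter n (localder h) f t).

Notation freering := {malg k[{cmonom nat}]}.

Definition gam (j : nat) : freering := mkmalgU (ucm j) 1.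

(* D = \sum_j gamma_{j+1} d/dgamma_j *)
Definition freeder (p : freering) : freering :=
  \sum_(m <- msupp p) \sum_(j <- finsupp m)
    mkmalgU (mulcm (ucm j.+1) (divcm m (ucm j))) (mcoeff m p *+ m j).

Definition psi_solution (psi : fps freering) :=
  psi 0%N = 0 /\
  fps_deriv psi = fps_map freeder psi - 1 - fpsC (gam 0) * psi ^+ 2.

Definition subst_gam (g : nat -> kernel) (p : freering) : kernel :=
  mmap (fun c => lC (lC c)) (fun m : {cmonom nat} => \prod_(j <- finsupp m) g j ^+ m j) p.

Definition psi_gamma h (e' e : nat -> K) (psi : fps freering) (s t : S) :
    fps kernel :=
  fps_map (subst_gam (fun j => iter j (derl h s) (gamma_kernel h e' e s t))) psi.

End LocalField.

Section Surface.
Variables (R : realType) (X : topologicalType).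

Notation C := (R[i] : numFieldType).

(* [coord] is only meaningful on [dom]. *)
Record chart := Chart { dom : set X; coord : X -> C }.

Definition is_chart (c : chart) :=
  [/\ open (dom c),
      {within dom c, continuous coord c},
      {in dom c &, injective (coord c)} &
      forall U, open U -> U `<=` dom c -> open (coord c @` U)].

Definition holomorphic_at (g : C -> C) (a : C) := \forall x \near a, derivable g x 1.

Definition holo_transition (c c' : chart) (p : X) (g : C -> C) :=
  holomorphic_at g (coord c p) /\ \forall x \near p, coord c' x = g (coord c x).

Definition compatible (c c' : chart) :=
  forall p, dom c p -> dom c' p ->
    (exists g, holo_transition c c' p g) /\ (exists g, holo_transition c' c p g).

Record complex_curve := ComplexCurve {
  atlas : set chart;
  atlas_chart : forall c, atlas c -> is_chart c;
  atlas_cover : forall p, exists2 c, atlas c & dom c p;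
  atlas_compatible : forall c c', atlas c -> atlas c' -> compatible c c';
  atlas_maximal : forall c, is_chart c ->
    (forall c', atlas c' -> compatible c c') -> atlas c }.

Variable XC : complex_curve.

(* A local coordinate at p need not vanish at p. *)
Definition local_coordinate (p : X) (c : chart) := atlas XC c /\ dom c p.

Definition holomorphic_on_curve_at (f : X -> C) (p : X) :=
  exists c g, [/\ local_coordinate p c, holomorphic_at g (coord c p) &
                  \forall x \near p, f x = g (coord c x)].

(* f = \sum_n a_n (c - c(p))^n on a punctured neighbourhood of p; the value of f
   at p plays no role *)
Definition laurent_expansion (c : chart) (p : X) (f : X -> C) (a : laurent C) :=
  exists N : nat, (forall n : int, n < - N%:Z -> a n = 0) /\
    \forall x \near p^', series (fun n : nat =>
      a (n%:Z - N%:Z) * (coord c x - coord c p) ^ (n%:Z - N%:Z)) @ \oo --> f x.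

(* omega = dcoef c . d(coord c) on the domain of each chart c, away from poles *)
Record mero_differential := MeroDifferential {
  dcoef : chart -> X -> C;
  dcoef_mero : forall c p, local_coordinate p c ->
    exists a, laurent_expansion c p (dcoef c) a;
  dcoef_transition : forall c c' p, local_coordinate p c -> local_coordinate p c' ->
    exists2 g, holo_transition c c' p g &
      \forall x \near p^', dcoef c x = dcoef c' x * derive1 g (coord c x) }.

Definition differential_expansion (om : mero_differential) c p (a : laurent C) :=
  laurent_expansion c p (dcoef om c) a.

Definition nonzero_differential (om : mero_differential) :=
  exists c p a, [/\ local_coordinate p c, differential_expansion om c p a & a != 0].

Definition has_order (a : laurent C) (d : int) :=
  a d != 0 /\ forall n : int, n < d -> a n = 0.

Definition zero_or_pole (om : mero_differential) (p : X) :=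
  exists c a d, [/\ local_coordinate p c, differential_expansion om c p a,
                    has_order a d & d != 0].

Variables (S : {fset X}) (z : S -> chart).

(* the image in \bigoplus_s C((z_s - z_s(s))) of the ring of meromorphic functions
   regular outside S *)
Definition regular_functions : set {ffun S -> laurent C} :=
  [set k | exists f : X -> C,
    (forall p, p \notin S -> holomorphic_on_curve_at f p) /\
    forall s : S, laurent_expansion (z s) (val s) f (k s)].

Definition coordinate_value (s : S) : C := coord (z s) (val s).

(* z_s = z_s(s) + (z_s - z_s(s)) *)
Definition coordinate_element : {ffun S -> laurent C} :=
  [ffun s => lC (coordinate_value s) + lvar C].

(* If s <> t and z_s(s) = z_t(t), then z_s - w_t is a non-unit of C((z_s, w_t)),
   while the Green kernel has no pole along z_s = w_t; an identity
   z_s - q^{-\partial} w_t = i [z_s - w_t + (z_s - w_t) G psi] would force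
   \partial w_t = 0 at first order in hbar. *)
Definition admissible_pair (s t : S) :=
  s = t \/ coordinate_value s <> coordinate_value t.

End Surface.

(* Main.v *)
(* Write [pi = z - w], [v = dz/omega], [F = pi (1 + G psi)] and [B = z - q^(-d) w].

   Near the diagonal [G = - v(z) / pi + r] with [r] in C((z, w)): the coefficients
   of [G] are those of minus the projection onto [Lambda] along [R], and [Lambda]
   contains all functions of high order, so the coefficient of [z^m] in [G] is
   explicit for [m] very negative.  Isotropy of [R] and [Lambda] makes [G]
   antisymmetric up to a delta function, and hence [2 r - (v(z) - v(w)) / pi] is
   antisymmetric and divisible by [pi]; this is what makes
   [gamma = dz G - G^2] regular.

   From the equation for [psi] one gets [(d/dhbar - dz) F = - (r + gamma psi) F],
   while [(d/dhbar - dz) B = - gt B] with [gt = e^(-hbar dw) ((v(z) - v(w)) / pi)].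
   Both operators have coefficients in C((z, w)), so the solution [i] of
   [(d/dhbar - dz) i = (r + gamma psi - gt) i], [i(0) = 1] lies in
   1 + hbar C((z, w))[[hbar]], and [B] and [i F] solve the same equation with the
   same initial value [pi].  When the components differ, [pi] is already
   invertible in C((z, w)). *)

Require Import Defs.
From HB Require Import structures.
From mathcomp Require Import all_boot all_order all_algebra.
From mathcomp Require Import finmap complex monalg zify ring.
From mathcomp Require Import all_classical all_reals all_analysis.

Set Implicit Arguments.
Unset Strict Implicit.
Unset Printing Implicit Defensive.

Import Order.TTheory GRing.Theory Num.Theory.
Import numFieldNormedType.Exports.

Local Open Scope classical_set_scope.
Local Open Scope ring_scope.

(** * Formal power series and Laurent series *)

(** Course-of-values recursion, as power series equations and Laurent inverses require. The lists
    [s n] are growing prefixes of the sequence, so an entry never changes once written. *)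
Lemma rec_sequence (T : Type) (a : T) (step : nat -> (nat -> T) -> T) :
  (forall n u v, (forall i, (i <= n)%N -> u i = v i) -> step n u = step n v) ->
  exists u : nat -> T, u 0%N = a /\ forall n, u n.+1 = step n u.
Proof.
move=> stepP.
pose s := fix s n := if n is m.+1 then rcons (s m) (step m (nth a (s m))) else [:: a].
have szs n : size (s n) = n.+1 by elim: n => //= n IH; rewrite size_rcons IH.
have sE n m i : (i <= n)%N -> (n <= m)%N -> nth a (s m) i = nth a (s n) i.
  move=> lein; elim: m => [|m IH]; first by rewrite leqn0 => /eqP ->.
  rewrite leq_eqVlt => /predU1P[-> //|]; rewrite ltnS => lenm.
  by rewrite /= nth_rcons szs ltnS (leq_trans lein lenm) IH.
exists (fun n => nth a (s n) n); split => // n.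
rewrite /= nth_rcons szs ltnn eqxx; apply: stepP => i lein.
exact: sE.
Qed.

Section Fps.
Context {A : comNzRingType}.
Implicit Types f g : fps A.

Lemma fpsDE f g n : (f + g) n = f n + g n. Proof. by []. Qed.
Lemma fpsNE f n : (- f) n = - f n. Proof. by []. Qed.
Lemma fpsBE f g n : (f - g) n = f n - g n. Proof. by []. Qed.
Lemma fpsME f g n : (f * g) n = \sum_(i < n.+1) f i * g (n - i)%N.
Proof. by []. Qed.

Lemma fpsCME a f n : (fpsC a * f) n = a * f n.
Proof.
rewrite fpsME big_ord_recl /= subn0 big1 ?addr0 // => i _.
by rewrite /bump /= mul0r.
Qed.

Lemma fpsC0 : fpsC 0 = 0 :> fps A.
Proof. by apply: fpsP => -[]. Qed.
Lemma fpsCD a b : fpsC (a + b) = fpsC a + fpsC b :> fps A.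
Proof. by apply: fpsP => -[|n]; rewrite fpsDE //= addr0. Qed.
Lemma fpsCN a : fpsC (- a) = - fpsC a :> fps A.
Proof. by apply: fpsP => -[|n]; rewrite fpsNE //= oppr0. Qed.
Lemma fpsCB a b : fpsC (a - b) = fpsC a - fpsC b :> fps A.
Proof. by rewrite fpsCD fpsCN. Qed.
Lemma fpsCM a b : fpsC (a * b) = fpsC a * fpsC b :> fps A.
Proof. by apply: fpsP => -[|n]; rewrite fpsCME //= mulr0. Qed.

Lemma fps_derivM f g : fps_deriv (f * g) = fps_deriv f * g + f * fps_deriv g.
Proof.
apply: fpsP => n; rewrite fpsDE !fpsME /=.
(* The weight [n + 1] splits as [i + (n + 1 - i)]; the term [i = 0] then drops out of the first sum
   and [i = n + 1] out of the second. *)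
have -> : (\sum_(i < n.+2) f i * g (n.+1 - i)%N) *+ n.+1 =
    \sum_(i < n.+2) (f i *+ i) * g (n.+1 - i)%N +
    \sum_(i < n.+2) f i * (g (n.+1 - i)%N *+ (n.+1 - i)).
  rewrite -big_split -sumrMnl; apply: eq_bigr => i _ /=.
  by rewrite mulrnAl mulrnAr -mulrnDr subnKC // -ltnS.
rewrite big_ord_recl /= mulr0n mul0r add0r; congr (_ + _).
rewrite big_ord_recr /= subnn mulr0n mulr0 addr0.
by apply: eq_bigr => i _; rewrite subSn // -ltnS.
Qed.

Lemma fps_derivD f g : fps_deriv (f + g) = fps_deriv f + fps_deriv g.
Proof. by apply: fpsP => n; rewrite fpsDE /= mulrnDl. Qed.

Lemma fps_derivC a : fps_deriv (fpsC a) = 0 :> fps A.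
Proof. by apply: fpsP => n; rewrite /= mul0rn. Qed.
End Fps.

Section FpsMap.
Context {A B : comNzRingType} (phi : {rmorphism A -> B}).
Implicit Types f g : fps A.

Lemma fps_mapM f g : fps_map phi (f * g) = fps_map phi f * fps_map phi g.
Proof.
apply: fpsP => n; rewrite fpsME /= rmorph_sum; apply: eq_bigr => i _.
exact: rmorphM.
Qed.
Lemma fps_map_sqr f : fps_map phi (f ^+ 2) = fps_map phi f ^+ 2.
Proof. exact: fps_mapM. Qed.
Lemma fps_mapB f g : fps_map phi (f - g) = fps_map phi f - fps_map phi g.
Proof. by apply: fpsP => n; rewrite fpsBE /= rmorphB. Qed.
Lemma fps_mapC a : fps_map phi (fpsC a) = fpsC (phi a).
Proof. by apply: fpsP => -[|n] //=; rewrite rmorph0. Qed.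
Lemma fps_map_deriv f : fps_map phi (fps_deriv f) = fps_deriv (fps_map phi f).
Proof. by apply: fpsP => n /=; rewrite rmorphMn. Qed.
End FpsMap.

Section Laurent.
Context {A : comNzRingType}.
Implicit Types f g : laurent A.

Lemma laurent0E n : (0 : laurent A) n = 0. Proof. by []. Qed.
Lemma laurent1E n : (1 : laurent A) n = (n == 0)%:R.
Proof. by transitivity (lC (1 : A) n) => //=; case: eqP. Qed.
Lemma laurentDE f g n : (f + g) n = f n + g n. Proof. by []. Qed.
Lemma laurentNE f n : (- f) n = - f n. Proof. by []. Qed.
Lemma laurentBE f g n : (f - g) n = f n - g n. Proof. by []. Qed.
Lemma laurentZE a f n : (a *: f) n = a * f n. Proof. by []. Qed.
Lemma laurent_sumE I (r : seq I) P (F : I -> laurent A) n :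
  (\sum_(i <- r | P i) F i) n = \sum_(i <- r | P i) F i n.
Proof. exact: (big_morph (fun f : laurent A => f n)). Qed.
Lemma laurentMnE f k n : (f *+ k) n = f n *+ k.
Proof. by elim: k => // k IH; rewrite !mulrS laurentDE IH. Qed.

Lemma laurentME (r : seq int) f g n : uniq r ->
  (forall k, k \notin r -> f k * g (n - k) = 0) ->
  (f * g) n = \sum_(k <- r) f k * g (n - k).
Proof.
move=> ur fgr; rewrite -[LHS]/(lmul_coef f g n) /lmul_coef (fsbigE r) //.
- by apply: eq_bigl => k; rewrite in_setT.
- by move=> k _; exact: fgr.
Qed.

Lemma laurent_bound f : exists N : int, forall n, n < N -> f n = 0.
Proof. by have [N fN] := lcoef_bounded f; exists (- N%:Z). Qed.

Definition zrange (a : int) (K : nat) : seq int := [seq a + i%:Z | i <- iota 0 K].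

Lemma zrange_uniq a K : uniq (zrange a K).
Proof. by rewrite map_inj_uniq ?iota_uniq // => i j /addrI []. Qed.

Lemma mem_zrange a K n : (n \in zrange a K) = (a <= n < a + K%:Z).
Proof.
apply/mapP/idP => [[j] | /andP [an nK]]; first by rewrite mem_iota => + ->; lia.
exists (absz (n - a)); first by rewrite mem_iota; lia.
by lia.
Qed.

Lemma laurentME_range (a b : int) (K : nat) f g n :
  (forall k, k < a -> f k = 0) -> (forall k, k < b -> g k = 0) ->
  n - b < a + K%:Z ->
  (f * g) n = \sum_(k <- zrange a K) f k * g (n - k).
Proof.
move=> fa gb nK; apply: laurentME; first exact: zrange_uniq.
move=> k; rewrite mem_zrange => kaK.
have [ka|ak] := ltP k a; first by rewrite fa ?mul0r.
by rewrite gb ?mulr0 //; move: kaK; lia.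
Qed.

Lemma laurentM_vanish (a b : int) f g n :
  (forall k, k < a -> f k = 0) -> (forall k, k < b -> g k = 0) ->
  n < a + b -> (f * g) n = 0.
Proof.
move=> fa gb nab; rewrite (@laurentME_range a b 0 f g n) //; last by lia.
by rewrite /zrange big_nil.
Qed.

Lemma lCME a f n : (lC a * f) n = a * f n.
Proof.
rewrite (@laurentME [:: 0]) // ?big_seq1 ?subr0 // => k.
by rewrite inE /= => /negbTE ->; rewrite mul0r.
Qed.

Lemma lvarME f n : (lvar A * f) n = f (n - 1).
Proof.
rewrite (@laurentME [:: 1]) // ?big_seq1 /= ?mul1r // => k.
by rewrite inE /= => /negbTE ->; rewrite mul0r.
Qed.

Lemma lCD a b : lC (a + b) = lC a + lC b :> laurent A.
Proof. by apply: laurentP => n; rewrite laurentDE /=; case: eqP; rewrite ?addr0. Qed.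
Lemma lCN a : lC (- a) = - lC a :> laurent A.
Proof. by apply: laurentP => n; rewrite laurentNE /=; case: eqP; rewrite ?oppr0. Qed.
Lemma lCM a b : lC (a * b) = lC a * lC b :> laurent A.
Proof. by apply: laurentP => n; rewrite lCME /=; case: eqP; rewrite ?mulr0. Qed.
Lemma lCZ a f : a *: f = lC a * f.
Proof. by apply: laurentP => n; rewrite lCME. Qed.

Lemma lscaleMl a f g : (a *: f) * g = a *: (f * g).
Proof. by rewrite !lCZ mulrA. Qed.
Lemma lscaleMr a f g : f * (a *: g) = a *: (f * g).
Proof. by rewrite !lCZ mulrCA. Qed.

Fact lC_is_zmod_morphism : zmod_morphism (@lC A).
Proof. by move=> a b; rewrite lCD lCN. Qed.
HB.instance Definition _ :=
  GRing.isZmodMorphism.Build A (laurent A) (@lC A) lC_is_zmod_morphism.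
Fact lC_is_monoid_morphism : monoid_morphism (@lC A).
Proof. by split => // a b; exact: lCM. Qed.
HB.instance Definition _ :=
  GRing.isMonoidMorphism.Build A (laurent A) (@lC A) lC_is_monoid_morphism.

Lemma lderivD f g : lderiv (f + g) = lderiv f + lderiv g.
Proof. by apply: laurentP => n; rewrite laurentDE /= mulrzDl. Qed.

Lemma lderivC (a : A) : lderiv (lC a) = 0.
Proof.
apply: laurentP => n /=; case: eqP => [->|_]; first by rewrite mulr0z.
by rewrite mul0rz.
Qed.

Lemma lderiv_var : lderiv (lvar A) = 1.
Proof.
apply: laurentP => n; rewrite laurent1E /=.
have -> : (n + 1 == 1) = (n == 0) by lia.
by have [->|_] := eqVneq n 0; rewrite ?add0r ?mul0rz.
Qed.

Lemma lderivM f g : lderiv (f * g) = lderiv f * g + f * lderiv g.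
Proof.
have [a fa] := laurent_bound f; have [b gb] := laurent_bound g.
have dfa k : k < a - 1 -> lderiv f k = 0.
  by move=> ka /=; rewrite fa ?mul0rz //; lia.
have dgb k : k < b - 1 -> lderiv g k = 0.
  by move=> kb /=; rewrite gb ?mul0rz //; lia.
apply: laurentP => n.
(* Long enough for all three products below. The range for [lderiv f] starts at [a - 1], so that
   moving [k] up by one carries it onto the range for [f]. *)
pose K := absz (n - a - b + 3).
have nK : n - a - b + 3 <= K%:Z by rewrite /K; lia.
rewrite laurentDE -[LHS]/((f * g) (n + 1) *~ (n + 1)).
rewrite (@laurentME_range a b K f g) //; last by lia.
rewrite (@laurentME_range a (b - 1) K f (lderiv g)) //; last by lia.
rewrite (@laurentME_range (a - 1) b K (lderiv f) g) //; last by lia.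
have -> : \sum_(k <- zrange (a - 1) K) lderiv f k * g (n - k) =
          \sum_(k <- zrange a K) (f k *~ k) * g (n + 1 - k).
  rewrite !big_map; apply: eq_bigr => i _ /=.
  by congr (f _ *~ _ * g _); lia.
rewrite -big_split /= -[LHS]mulrzr mulr_suml; apply: eq_bigr => k _.
rewrite (_ : n - k + 1 = n + 1 - k); last by lia.
have -> : (n + 1)%:~R = k%:~R + (n + 1 - k)%:~R :> A by rewrite -intrD subrKC.
by rewrite -mulrzr -[g _ *~ _]mulrzr; ring.
Qed.

End Laurent.

Lemma bounded_below_map (A B : nmodType) (phi : A -> B) (f : laurent A) :
  phi 0 = 0 -> bounded_below (phi \o f).
Proof.
by move=> phi0; have [N fN] := lcoef_bounded f; exists N => n /fN /= ->.
Qed.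

Lemma laurent_ofE (A : comNzRingType) (f : int -> A) n :
  bounded_below f -> laurent_of f n = f n.
Proof. by rewrite /laurent_of; case: pselect. Qed.

Lemma lmapE (A B : comNzRingType) (phi : A -> B) (f : laurent A) n :
  phi 0 = 0 -> lmap phi f n = phi (f n).
Proof. by move=> phi0; rewrite /lmap laurent_ofE //; exact: bounded_below_map. Qed.

(** * Linear differential equations in hbar *)

Definition derivation (Q : comNzRingType) (d : Q -> Q) :=
  (forall x y, d (x + y) = d x + d y) /\
  (forall x y, d (x * y) = d x * y + x * d y).

Section Derivation.
Context {Q : comNzRingType} {d : Q -> Q} (der_d : derivation d).

Lemma derD x y : d (x + y) = d x + d y. Proof. exact: der_d.1. Qed.
Lemma derM x y : d (x * y) = d x * y + x * d y. Proof. exact: der_d.2. Qed.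
Lemma der0 : d 0 = 0.
Proof. by apply: (addrI (d 0)); rewrite -derD !addr0. Qed.
Lemma der1 : d 1 = 0.
Proof.
by apply: (addrI (d 1)); rewrite addr0 -[in RHS](mulr1 1) derM mulr1 mul1r.
Qed.
Lemma derN x : d (- x) = - d x.
Proof. by apply: (addrI (d x)); rewrite -derD !subrr der0. Qed.
Lemma derB x y : d (x - y) = d x - d y. Proof. by rewrite derD derN. Qed.
Lemma derMn x n : d (x *+ n) = d x *+ n.
Proof. by elim: n => [|n IH]; rewrite ?der0 // !mulrS derD IH. Qed.
Lemma der_sum I (r : seq I) (F : I -> Q) :
  d (\sum_(i <- r) F i) = \sum_(i <- r) d (F i).
Proof. exact: (big_morph d derD der0). Qed.
Lemma derX x n : d (x ^+ n) = x ^+ n.-1 * d x *+ n.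
Proof.
case: n => [|n]; first by rewrite expr0 der1 mulr0n.
elim: n => [|n IH]; first by rewrite !expr1 expr0 mul1r.
by rewrite exprS derM IH /= exprS -mulr_natr -[RHS]mulr_natr -natr1; ring.
Qed.
Lemma der_prod (I : eqType) (r : seq I) (F : I -> Q) : uniq r ->
  d (\prod_(i <- r) F i) = \sum_(i <- r) d (F i) * \prod_(j <- r | j != i) F j.
Proof.
elim: r => [_|a r IH /= /andP[ar ur]]; first by rewrite !big_nil der1.
rewrite !big_cons derM IH // eqxx /=; congr (_ * _ + _).
  by rewrite big_seq [RHS]big_seq_cond; apply: eq_bigl => i; case: eqP => [->|];
    rewrite ?andbT ?andbF // (negbTE ar).
rewrite mulr_sumr; apply: eq_big_seq => i ir.
rewrite big_cons; have -> : a != i by apply: contraNneq ar => ->.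
by ring.
Qed.

Lemma fps_map_derivation : derivation (fps_map d).
Proof.
split=> f g; apply: fpsP => n; first by rewrite fpsDE /= derD.
rewrite fpsDE !fpsME /= -big_split /= der_sum; apply: eq_bigr => i _.
exact: derM.
Qed.

Lemma fps_map_derC x : fps_map d (fpsC x) = fpsC (d x).
Proof. by apply: fpsP => -[|n] //=; rewrite der0. Qed.

Lemma fps_map_der_deriv f : fps_deriv (fps_map d f) = fps_map d (fps_deriv f).
Proof. by apply: fpsP => n /=; rewrite derMn. Qed.
End Derivation.

Lemma oppr_derivation (Q : comNzRingType) (d : Q -> Q) :
  derivation d -> derivation (fun x => - d x).
Proof.
move=> der_d; split=> x y; first by rewrite (derD der_d) opprD.
by rewrite (derM der_d) opprD mulNr mulrN.
Qed.

Lemma fps_deriv_derivation (Q : comNzRingType) : derivation (@fps_deriv Q).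
Proof. by split; [exact: fps_derivD | exact: fps_derivM]. Qed.

Lemma fps_odeE (Q : comNzRingType) (d : Q -> Q) (c f : fps Q) n :
  fps_deriv f = fps_map d f + c * f ->
  f n.+1 *+ n.+1 = d (f n) + \sum_(i < n.+1) c i * f (n - i)%N.
Proof. by move=> /(congr1 (fun u : fps Q => u n)). Qed.

(** The coefficient of hbar^n expresses (n + 1) f_(n+1) through f_0, ..., f_n; without additive
    torsion the initial value determines the series. *)
Lemma fps_ode_unique {Q : comNzRingType} {d : Q -> Q} (c f g : fps Q) :
  derivation d -> (forall n (x : Q), x *+ n.+1 = 0 -> x = 0) ->
  fps_deriv f = fps_map d f + c * f -> fps_deriv g = fps_map d g + c * g ->
  f 0%N = g 0%N -> f = g.
Proof.
move=> der_d tf fE gE fg0; apply: fpsP => n; elim/ltn_ind: n => -[//|n] IH.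
apply/eqP; rewrite -subr_eq0; apply/eqP; apply: (tf n); rewrite mulrnBl.
rewrite (fps_odeE n fE) (fps_odeE n gE) IH //.
rewrite -[RHS](subrr (d (g n) + \sum_(i < n.+1) c i * g (n - i)%N)).
congr (_ + _ - _); apply: eq_bigr => i _.
by rewrite IH // ltnS leq_subr.
Qed.

Section LinearOde.
Context {Q : comNzRingType} (M : Q -> Prop).
Hypotheses (M1 : M 1) (MB : forall x y, M x -> M y -> M (x - y))
  (MM : forall x y, M x -> M y -> M (x * y))
  (Mnat : forall n, exists2 x, M x & x *+ n.+1 = 1).

Let M0 : M 0. Proof. by rewrite -(subrr 1); apply: MB. Qed.
Let MN x : M x -> M (- x). Proof. by move=> Mx; rewrite -sub0r; apply: MB. Qed.
Let MD x y : M x -> M y -> M (x + y).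
Proof. by move=> Mx My; rewrite -[y]opprK; apply/MB => //; apply: MN. Qed.
Let Msum I (r : seq I) (F : I -> Q) : (forall i, M (F i)) -> M (\sum_(i <- r) F i).
Proof. by move=> MF; elim/big_ind: _. Qed.

Lemma mulrn_torsion_free n (x : Q) : x *+ n.+1 = 0 -> x = 0.
Proof.
have [c _ cn] := Mnat n; move=> xn.
by rewrite -[x]mulr1 -cn mulrnAr -mulrnAl xn mul0r.
Qed.

(** The recursion for the coefficients is solved by dividing by [n + 1] within [M]. As [M] is a
    subring stable under [d], the coefficients never leave it; [M] will be C((z, w)) inside the ring
    of kernels. *)
Lemma fps_ode_solution (d : Q -> Q) (c : fps Q) a :
  (forall x, M x -> M (d x)) -> (forall n, M (c n)) -> M a ->
  exists f : fps Q, [/\ f 0%N = a, forall n, M (f n) &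
    fps_deriv f = fps_map d f + c * f].
Proof.
move=> Md Mc Ma.
have /choice[kap kapP] n : exists x, M x /\ x *+ n.+1 = 1.
  by have [x] := Mnat n; exists x.
pose step n (u : nat -> Q) :=
  kap n * (d (u n) + \sum_(i < n.+1) c i * u (n - i)%N).
have [|u [u0 uS]] := @rec_sequence Q a step.
  move=> n u v uv; rewrite /step uv //; congr (_ * (_ + _)).
  by apply: eq_bigr => i _; rewrite uv // leq_subr.
exists (Fps u); split => //= [n|].
  elim/ltn_ind: n => -[|n] IH; first by rewrite u0.
  rewrite uS; apply: MM; first by case: (kapP n).
  apply: MD; first exact/Md/IH.
  by apply: Msum => i; apply: MM => //; apply: IH; rewrite ltnS leq_subr.
apply: fpsP => n; rewrite fpsDE fpsME /= uS /step.
by rewrite -mulrnAl (kapP n).2 mul1r.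
Qed.

(* Both sides of the conclusion satisfy the linear equation
   [(d/dhbar - dz) Y = - gt Y], where [gt = e^(- hbar dw) g], and both start at
   [zs - wt].  For the left-hand side this follows by applying [e^(- hbar dw)] to
   [hg]; for the bracket [F] one has [(d/dhbar - dz) F = - (r + gamma Psi) F],
   so that [i] only has to solve a linear equation with coefficients in [M]. *)
Lemma kernel_ode (dz dw : Q -> Q) (zs wt v G r g gamma : Q) (U Psi : fps Q) :
  derivation dz -> derivation dw ->
  (forall x, M x -> M (dz x)) -> (forall x, M x -> M (dw x)) ->
  dz zs = v -> dw zs = 0 -> dw v = 0 ->
  U 0%N = wt -> fps_deriv U = - fps_map dw U -> fps_map dz U = 0 ->
  M r -> M g -> M gamma -> (forall n, M (Psi n)) ->
  (zs - wt) * r = (zs - wt) * G + v ->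
  (zs - wt) * g = v - dw wt ->
  dz G = gamma + G ^+ 2 ->
  Psi 0%N = 0 ->
  fps_deriv Psi = fps_map dz Psi - 1 - fpsC gamma * Psi ^+ 2 ->
  exists i : fps Q, [/\ i 0%N = 1, forall n, M (i n) &
    fpsC zs - U = i * (fpsC (zs - wt) + fpsC ((zs - wt) * G) * Psi)].
Proof.
move=> derz derw Mdz Mdw dzz dwz dwv U0 Uode dzU Mr Mg Mgamma MPsi hr hg hG Psi0.
move=> Psiode.
have derNw := oppr_derivation derw.
have derFz := fps_map_derivation derz.
have derFw := fps_map_derivation derw.
have der' := fps_deriv_derivation Q.
have mapN (f : fps Q) : fps_map (fun x => - dw x) f = - fps_map dw f.
  exact: fpsP.
have dzwt : dz wt = 0 by rewrite -U0; have := congr1 (fun u : fps Q => u 0%N) dzU.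
have [||//|gt [gt0 Mgt gtode]] := @fps_ode_solution (fun x => - dw x) 0 g.
- by move=> x Mx; apply/MN/Mdw.
- by move=> n; exact: M0.
set B := fpsC zs - U; set P := zs - wt.
have dzP : dz P = v by rewrite (derB derz) dzz dzwt subr0.
have B0 : B 0%N = P by rewrite /B fpsBE U0.
(* This is [hg] transported by e^(- hbar dw): both sides solve Y' = - dw Y, and at hbar = 0 they are
   the two sides of [hg]. *)
have Eode : fpsC v - fps_map dw U = gt * B.
  apply: (fps_ode_unique (c := 0) derNw mulrn_torsion_free).
  - rewrite mapN (derB der') (derB derFw) !fps_derivC (fps_map_derC derw) dwv.
    rewrite (fps_map_der_deriv derw) Uode (derN derFw) mul0r addr0.
    by rewrite ?fpsC0; ring.
  - rewrite mapN (derM der') (derM derFw) gtode mapN (derB der') (derB derFw).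
    rewrite fps_derivC (fps_map_derC derw) dwz Uode.
    by rewrite ?fpsC0; ring.
  - by rewrite fpsME big_ord1 subn0 B0 gt0 fpsBE /= U0 mulrC.
have Bode : fps_deriv B = fps_map dz B + (- gt) * B.
  rewrite mulNr -Eode (derB der') (derB derFz) dzU fps_derivC Uode.
  by rewrite (fps_map_derC derz) dzz; ring.
(* The coefficient is the difference between [- gt], which governs [B], and - (r + gamma Psi), which
   governs the bracket; multiplying by [i] therefore converts one equation into the other. *)
have [||//|i [i0 Mi iode]] :=
    @fps_ode_solution dz (fpsC r + fpsC gamma * Psi - gt) 1.
- by [].
- move=> n; rewrite fpsBE fpsDE fpsCME; apply: MB => //; apply: MD.
    by case: n.
  exact: MM.
exists i; split => //.
apply: (fps_ode_unique derz mulrn_torsion_free Bode).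
- set F := (X in i * X).
  have Fode : fps_deriv F = fps_map dz F - (fpsC r + fpsC gamma * Psi) * F.
    rewrite /F (derD der') (derD derFz) !fps_derivC add0r (derM der').
    rewrite (derM derFz) fps_derivC mul0r add0r !(fps_map_derC derz).
    rewrite dzP (derM derz) dzP hG Psiode.
    (* Eliminating [v] through [hr] makes the [G ^+ 2] coming from [dz G] cancel, after which both
       sides are the same polynomial. *)
    have vE : fpsC v = fpsC P * fpsC r - fpsC P * fpsC G.
      by rewrite -!fpsCM -fpsCB hr addrC addKr.
    rewrite (fpsCD (v * G)) !(fpsCM v, fpsCM P) (fpsCD gamma) expr2 (fpsCM G) vE.
    by ring.
  by rewrite (derM der') (derM derFz) iode Fode; ring.
- by rewrite B0 fpsME big_ord1 subn0 i0 mul1r fpsDE fpsCME Psi0 mulr0 addr0.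
Qed.
End LinearOde.

(** * Substitution of the free variables *)

Section SubstGam.
Context {k : fieldType}.
Notation kernel := (laurent (laurent k)).
Notation freering := {malg k[{cmonom nat}]}.

Definition kconst (c : k) : kernel := lC (lC c).

Fact kconst_is_zmod_morphism : zmod_morphism kconst.
Proof. by move=> a b; rewrite /kconst !rmorphB. Qed.
HB.instance Definition _ :=
  GRing.isZmodMorphism.Build k kernel kconst kconst_is_zmod_morphism.
Fact kconst_is_monoid_morphism : monoid_morphism kconst.
Proof. by split=> [|a b]; rewrite /kconst ?rmorph1 // !rmorphM. Qed.
HB.instance Definition _ :=
  GRing.isMonoidMorphism.Build k kernel kconst kconst_is_monoid_morphism.

Section GamMonom.
Variable g : nat -> kernel.

Definition gam_monom (m : {cmonom nat}) : kernel :=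
  \prod_(j <- finsupp m) g j ^+ m j.

Lemma gam_monomEw (d : {fset nat}) (m : {cmonom nat}) :
  (finsupp m `<=` d)%fset -> gam_monom m = \prod_(j <- d) g j ^+ m j.
Proof.
move=> md; apply: big_fset_incl => // j _.
by rewrite memNfinsupp => /eqP ->; rewrite expr0.
Qed.

Fact gam_monom_is_mmorphism : mmorphism gam_monom.
Proof.
split=> [m1 m2|]; last by rewrite /gam_monom mdom1 big_seq_fset0.
have md := mdomD m1 m2; pose d := (finsupp m1 `|` finsupp m2)%fset.
rewrite !(@gam_monomEw d) ?fsubsetUl ?fsubsetUr ?md //.
by rewrite -big_split /=; apply: eq_bigr => j _; rewrite cmM exprD.
Qed.
HB.instance Definition _ :=
  isMultiplicative.Build {cmonom nat} kernel gam_monom gam_monom_is_mmorphism.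

Lemma gam_monomU j : gam_monom (ucm j) = g j.
Proof. by rewrite /gam_monom mdomU big_seq_fset1 cmUU expr1. Qed.

HB.instance Definition _ :=
  GRing.RMorphism.copy (subst_gam g) (mmap kconst gam_monom).

Lemma subst_gam_sum I (r : seq I) (F : I -> freering) :
  subst_gam g (\sum_(i <- r) F i) = \sum_(i <- r) subst_gam g (F i).
Proof. exact: raddf_sum. Qed.
Lemma subst_gamU c m : subst_gam g (mkmalgU m c) = kconst c * gam_monom m.
Proof. by rewrite -[LHS]/(mmap kconst gam_monom _) mmapU. Qed.
Lemma subst_gam_gam j : subst_gam g (gam k j) = g j.
Proof. by rewrite subst_gamU rmorph1 mul1r gam_monomU. Qed.

Lemma gam_monom_divcm (m : {cmonom nat}) j : (0 < m j)%N ->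
  gam_monom (divcm m (ucm j)) =
  g j ^+ (m j).-1 * \prod_(i <- finsupp m | i != j) g i ^+ m i.
Proof.
move=> mj; have jm : j \in finsupp m by rewrite mem_finsupp -lt0n.
rewrite (@gam_monomEw (finsupp m)); last first.
  apply/fsubsetP => i; rewrite !mem_finsupp divcmE.
  by apply: contraNneq => ->.
rewrite (bigD1_seq j) ?fset_uniq //= divcmE ucmE eqxx subn1; congr (_ * _).
by apply: eq_bigr => i ij; rewrite divcmE ucmE eq_sym (negbTE ij) subn0.
Qed.

(** A derivation that kills constants is determined by its values on the variables, and [freeder]
    also sends each variable to the next. Since [freeder] is given monomial by monomial, the Leibniz
    rule is expanded on each monomial. *)
Lemma subst_gam_derivation (d : kernel -> kernel) p :
  derivation d -> (forall c, d (kconst c) = 0) -> (forall j, d (g j) = g j.+1) ->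
  d (subst_gam g p) = subst_gam g (freeder p).
Proof.
move=> derd dC dg; rewrite /freeder subst_gam_sum.
rewrite -[subst_gam g p]/(mmap kconst gam_monom p) mmapE.
rewrite (der_sum derd); apply: eq_bigr => m _.
rewrite (derM derd) dC mul0r add0r subst_gam_sum (der_prod derd) ?fset_uniq //.
rewrite mulr_sumr; apply: eq_big_seq => j; rewrite mem_finsupp -lt0n => mj.
have gmM m1 m2 : gam_monom (mulcm m1 m2) = gam_monom m1 * gam_monom m2.
  exact: (mmorphM gam_monom).
rewrite subst_gamU gmM gam_monomU gam_monom_divcm // (derX derd) dg.
by rewrite raddfMn /= !mulrnAl mulrnAr [_ ^+ _ * _]mulrC -!mulrA.
Qed.
End GamMonom.
End SubstGam.

(** * Kernels and the subring C((z, w)) *)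

Lemma bounded_below_int (A : nmodType) (f : int -> A) (N : int) :
  (forall n, n < N -> f n = 0) -> bounded_below f.
Proof. by move=> fN; exists (absz N) => n nN; apply: fN; lia. Qed.

Lemma laurentMzE (A : comNzRingType) (f : laurent A) (i n : int) :
  (f *~ i) n = f n *~ i.
Proof.
by case: i => i; rewrite ?NegzE ?mulrNz -?pmulrn ?laurentNE laurentMnE.
Qed.

Section Monomial.
Context {A : comNzRingType}.

Fact lmono_bounded (p : int) : bounded_below (fun n : int => (n == p)%:R : A).
Proof. by apply: (@bounded_below_int _ _ p) => n np; rewrite lt_eqF. Qed.
Definition lmono p : laurent A := Laurent (lmono_bounded p).

Lemma lmonoME p f n : (lmono p * f) n = f (n - p).
Proof.
rewrite (@laurentME _ [:: p]) // ?big_seq1 /= ?eqxx ?mul1r // => k.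
by rewrite inE /= => /negbTE ->; rewrite mul0r.
Qed.
End Monomial.

Lemma laurent_field_unit (k : fieldType) (f : laurent k) : f != 0 -> f \is a GRing.unit.
Proof.
move=> f0; have [a fa] := laurent_bound f.
have exf : exists i : nat, f (a + i%:Z) != 0.
  apply: contrapT => /forallNP nf; move/eqP: f0; apply; apply: laurentP => n.
  rewrite laurent0E; have [|an] := ltP n a; first exact: fa.
  have := nf (absz (n - a)); rewrite gez0_abs ?subr_ge0 // subrKC.
  by move=> /negP; rewrite negbK => /eqP.
case: (ex_minnP exf) => i fi0 imin.
set d := a + i%:Z; have fd n : n < d -> f n = 0.
  have [/fa //|an nd] := ltP n a.
  apply/eqP; apply: contraT => fn0.
  by have := imin (absz (n - a)); rewrite gez0_abs ?subr_ge0 // subrKC => /(_ fn0); lia.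
(* [u j] is the coefficient of the inverse at exponent [j - d]; the recursion makes the coefficient
   of the product at [n + 1] vanish. *)
pose step n (u : nat -> k) :=
  - (f d)^-1 * \sum_(j < n.+1) u j * f (d + (n.+1 - j)%N%:Z).
have [|u [u0 uS]] := @rec_sequence k (f d)^-1 step.
  move=> n u v uv; rewrite /step; congr (_ * _); apply: eq_bigr => j _.
  by rewrite uv // -ltnS.
pose gc (n : int) := if 0 <= n + d then u (absz (n + d)) else 0.
have gcd n : n < - d -> gc n = 0 by rewrite /gc => nd; case: leP => //; lia.
pose g := Laurent (@bounded_below_int _ gc (- d) gcd).
have gE (j : nat) : g (- d + j%:Z) = u j by rewrite /= /gc addrAC addNr add0r.
apply/unitrPr; exists g; rewrite mulrC.
apply: laurentP => n; rewrite laurent1E.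
have [n0|] := ltP n 0.
  by rewrite (@laurentM_vanish _ (- d) d g f) ?addNr // lt_eqF.
case: n => // n _; rewrite (@laurentME_range _ (- d) d n.+1 g f) //; last by lia.
rewrite big_map -[iota 0 _]/(index_iota 0 n.+1) big_mkord.
have -> : \sum_(j < n.+1) g (- d + j%:Z) * f (n%:Z - (- d + j%:Z)) =
    \sum_(j < n.+1) u j * f (d + (n - j)%N%:Z).
  by apply: eq_bigr => j _; rewrite gE; congr (_ * f _); have := ltn_ord j; lia.
case: n => [|n]; first by rewrite big_ord1 addr0 u0 mulVf.
rewrite big_ord_recr /= subnn addr0 uS /step !mulNr mulrAC mulVf //.
by rewrite mul1r subrr.
Qed.

Section Tensor.
Context {k : fieldType}.
Notation kernel := (laurent (laurent k)).
Implicit Types (f c : laurent k) (F : kernel).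

Lemma tenslE f n m : tensl f n m = if n == 0 then f m else 0.
Proof. by rewrite /tensl /=; case: eqP. Qed.
Lemma tensrE f n : tensr f n = lC (f n).
Proof. by rewrite /tensr lmapE ?raddf0. Qed.

Lemma tensrD f c : tensr (f + c) = tensr f + tensr c.
Proof. by apply: laurentP => n; rewrite laurentDE !tensrE raddfD. Qed.
Lemma tensrN f : tensr (- f) = - tensr f.
Proof. by apply: laurentP => n; rewrite laurentNE !tensrE raddfN. Qed.
Lemma tensrM f c : tensr (f * c) = tensr f * tensr c.
Proof.
have [a fa] := laurent_bound f; have [b cb] := laurent_bound c.
apply: laurentP => n; pose K := absz (n - a - b + 1).
have aK : n - b < a + K%:Z by rewrite /K; lia.
rewrite (@laurentME_range _ a b K (tensr f) (tensr c)) //; last first.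
- by move=> i ib; rewrite tensrE cb ?rmorph0.
- by move=> i ia; rewrite tensrE fa ?rmorph0.
rewrite tensrE (@laurentME_range _ a b K f c) // rmorph_sum /=.
by apply: eq_bigr => i _; rewrite !tensrE rmorphM.
Qed.
Lemma tensrMn f n : tensr (f *+ n) = tensr f *+ n.
Proof. by apply: laurentP => m; rewrite laurentMnE !tensrE laurentMnE rmorphMn. Qed.
Lemma tensrC a : tensr (lC a) = lC (lC a) :> kernel.
Proof. by apply: laurentP => n; rewrite tensrE /=; case: eqP; rewrite ?rmorph0. Qed.
Lemma tensr_var : tensr (lvar k) = lvar (laurent k).
Proof.
by apply: laurentP => n; rewrite tensrE /=; case: eqP; rewrite ?rmorph1 ?rmorph0.
Qed.

Lemma der_lderiv_scale c : derivation (fun f => lderiv f * c).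
Proof.
split=> f g; first by rewrite lderivD mulrDl.
by rewrite lderivM mulrDl mulrAC -!mulrA.
Qed.

Section Derl.
Context (S : finType) (h : S -> laurent k) (s : S).

Let derh : derivation (fun f => lderiv f / h s) := der_lderiv_scale _.

Lemma derlE F n : derl h s F n = lderiv (F n) / h s.
Proof. by rewrite /derl lmapE // (der0 derh). Qed.

Lemma derl_derivation : derivation (derl h s).
Proof.
split=> F G; apply: laurentP => n; rewrite laurentDE !derlE ?(derD derh) //.
have [a Fa] := laurent_bound F; have [b Gb] := laurent_bound G.
pose K := absz (n - a - b + 1).
have aK : n - b < a + K%:Z by rewrite /K; lia.
have dF i : i < a -> derl h s F i = 0 by move=> ia; rewrite derlE Fa ?(der0 derh).
have dG i : i < b -> derl h s G i = 0 by move=> ib; rewrite derlE Gb ?(der0 derh).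
rewrite (@laurentME_range _ a b K F G) //.
rewrite (@laurentME_range _ a b K (derl h s F) G) //.
rewrite (@laurentME_range _ a b K F (derl h s G)) //.
rewrite (der_sum derh) -big_split /=; apply: eq_bigr => i _.
by rewrite (derM derh) !derlE.
Qed.

Lemma derl_tensl f : derl h s (tensl f) = tensl (lderiv f / h s).
Proof.
apply: laurentP => n; rewrite derlE /tensl /=; case: eqP => // _.
exact: (der0 derh).
Qed.
Lemma derl_tensr f : derl h s (tensr f) = 0.
Proof. by apply: laurentP => n; rewrite derlE tensrE lderivC mul0r. Qed.
Lemma derl_kconst a : derl h s (kconst a) = 0.
Proof. by rewrite /kconst -tensrC derl_tensr. Qed.
End Derl.

(** For [c] the inverse of the expansion of omega, this is [1 \otimes \partial], the derivation in
    the outer variable w. *)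
Definition derr c F : kernel := lderiv F * tensr c.

Lemma derr_derivation c : derivation (derr c).
Proof. split=> F G; rewrite /derr; first by rewrite lderivD mulrDl.
by rewrite lderivM mulrDl mulrAC -!mulrA. Qed.
Lemma derr_tensl c f : derr c (tensl f) = 0.
Proof. by rewrite /derr lderivC mul0r. Qed.
Lemma derr_tensr c f : derr c (tensr f) = tensr (lderiv f * c).
Proof.
rewrite tensrM /derr; suff -> : lderiv (tensr f) = tensr (lderiv f) by [].
apply: laurentP => n; rewrite tensrE -[LHS]/(tensr f (n + 1) *~ (n + 1)) tensrE.
by rewrite -[lderiv f n]/(f (n + 1) *~ (n + 1)) raddfMz.
Qed.

(* The bound on the exponents of [w] is part of being a Laurent series in [w]. *)
Lemma klaurent2P F :
  in_klaurent2 F <-> exists N : int, forall m n : int, m < N -> F n m = 0.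
Proof.
split=> [[N FN]|[N FN]]; first by exists N => m n mN; apply: (FN m n); left.
have [a Fa] := laurent_bound F; exists (Num.min N a) => m n [].
  by rewrite lt_min => /andP[mN _]; exact: FN.
by rewrite lt_min => /andP[_ na]; rewrite Fa.
Qed.

Lemma klaurent2_tensl f : in_klaurent2 (tensl f).
Proof.
have [a fa] := laurent_bound f; apply/klaurent2P; exists a => m n ma.
by rewrite tenslE fa ?if_same.
Qed.
Lemma klaurent2_tensr f : in_klaurent2 (tensr f).
Proof.
apply/klaurent2P; exists 0 => m n ma.
by rewrite tensrE /= lt_eqF.
Qed.
Lemma klaurent2_1 : in_klaurent2 (1 : kernel).
Proof. exact: (klaurent2_tensl 1). Qed.
Lemma klaurent2B F G : in_klaurent2 F -> in_klaurent2 G -> in_klaurent2 (F - G).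
Proof.
move=> /klaurent2P[a Fa] /klaurent2P[b Gb]; apply/klaurent2P.
exists (Num.min a b) => m n; rewrite lt_min => /andP[ma mb].
by rewrite !laurentBE Fa // Gb // subr0.
Qed.
Lemma klaurent2D F G : in_klaurent2 F -> in_klaurent2 G -> in_klaurent2 (F + G).
Proof.
move=> /klaurent2P[a Fa] /klaurent2P[b Gb]; apply/klaurent2P.
exists (Num.min a b) => m n; rewrite lt_min => /andP[ma mb].
by rewrite !laurentDE Fa // Gb // addr0.
Qed.
Lemma klaurent2M F G : in_klaurent2 F -> in_klaurent2 G -> in_klaurent2 (F * G).
Proof.
move=> /klaurent2P[a Fa] /klaurent2P[b Gb]; apply/klaurent2P.
have [a' Fa'] := laurent_bound F; have [b' Gb'] := laurent_bound G.
exists (a + b) => m n mab.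
rewrite (@laurentME_range _ a' b' (absz (n - b' - a' + 1))) //; last by lia.
rewrite laurent_sumE big1 // => i _.
by apply: (@laurentM_vanish _ a b) => // j; [exact: Fa | exact: Gb].
Qed.
Lemma klaurent2_derl (S : finType) (h : S -> laurent k) s F :
  in_klaurent2 F -> in_klaurent2 (derl h s F).
Proof.
move=> /klaurent2P[a Fa]; have [b hb] := laurent_bound (h s)^-1.
apply/klaurent2P; exists (a - 1 + b) => m n mab; rewrite derlE.
apply: (@laurentM_vanish _ (a - 1) b) => // j ja /=.
by rewrite Fa ?mul0rz //; lia.
Qed.
Lemma klaurent2_derr c F : in_klaurent2 F -> in_klaurent2 (derr c F).
Proof.
move=> /klaurent2P[a Fa]; apply/klaurent2M/klaurent2_tensr.
by apply/klaurent2P; exists a => m n ma; rewrite laurentMzE Fa ?mul0rz.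
Qed.
Lemma klaurent2_sum I (r : seq I) (P : pred I) (F : I -> kernel) :
  (forall i, in_klaurent2 (F i)) -> in_klaurent2 (\sum_(i <- r | P i) F i).
Proof.
move=> MF; elim/big_ind: _ => //; last exact: klaurent2D.
by rewrite -(subrr 1); apply: klaurent2B klaurent2_1 klaurent2_1.
Qed.
Lemma klaurent2_prod I (r : seq I) (P : pred I) (F : I -> kernel) :
  (forall i, in_klaurent2 (F i)) -> in_klaurent2 (\prod_(i <- r | P i) F i).
Proof. by move=> MF; elim/big_ind: _ => //; [exact: klaurent2_1|exact: klaurent2M]. Qed.
Lemma klaurent2X F n : in_klaurent2 F -> in_klaurent2 (F ^+ n).
Proof.
move=> MF; elim: n => [|n IH]; first exact: klaurent2_1.
by rewrite exprS; apply: klaurent2M.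
Qed.
Lemma klaurent2_kconst (a : k) : in_klaurent2 (kconst a).
Proof. exact: klaurent2_tensl. Qed.

Lemma klaurent2_subst_gam (g : nat -> kernel) p :
  (forall j, in_klaurent2 (g j)) -> in_klaurent2 (subst_gam g p).
Proof.
move=> Mg; rewrite -[subst_gam g p]/(mmap kconst (gam_monom g) p) mmapE.
apply: klaurent2_sum => m; apply: klaurent2M (klaurent2_kconst _) _.
by apply: klaurent2_prod => j; exact: klaurent2X.
Qed.

Lemma klaurent2_of (N : int) (F : int -> int -> k) :
  (forall m n : int, m < N \/ n < N -> F n m = 0) ->
  exists2 K : kernel, in_klaurent2 K & forall n m, K n m = F n m.
Proof.
move=> FN.
pose row n := Laurent (@bounded_below_int _ (F n) N (fun m mN => FN m n (or_introl mN))).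
have rowN n : n < N -> row n = 0.
  by move=> nN; apply: laurentP => m; apply: (FN m n); right.
exists (Laurent (@bounded_below_int _ row N rowN)) => //.
by apply/klaurent2P; exists N => m n mN; apply: (FN m n); left.
Qed.

End Tensor.

(** * Division by z - w *)

Section DiagonalDivision.
Context {k : fieldType}.
Notation kernel := (laurent (laurent k)).

(** The difference z_s - w_t in series variables centred at the two points, where the coordinates
    take the values [a] and [b]. *)
Definition diff_kernel (a b : k) : kernel :=
  tensl (lC a + lvar k) - tensr (lC b + lvar k).

Lemma diff_kernelME a b (F : kernel) n m :
  (diff_kernel a b * F) n m = (a - b) * F n m + F n (m - 1) - F (n - 1) m.
Proof.
rewrite /diff_kernel mulrBl laurentBE.
rewrite tensrD tensrC tensr_var.
rewrite [(tensl _ * F) n]lCME mulrDl laurentDE lCME lvarME.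
rewrite mulrDl laurentDE lCME (@lvarME (laurent k)).
by rewrite lCME mulrBl opprD addrACA addrA.
Qed.

Lemma kernelP (F G : kernel) : (forall n m, F n m = G n m) -> F = G.
Proof. by move=> FG; apply: laurentP => n; apply: laurentP. Qed.

Lemma kernel1E n m : (1 : kernel) n m = ((n == 0) && (m == 0))%:R.
Proof. by rewrite laurent1E; case: eqP => _; rewrite ?laurent1E. Qed.

(** Divided differences of powers: (z^p - w^p) / (z - w) is the sum of z^m w^n over m, n >= 0 with m
    + n + 1 = p when p > 0, and minus such a sum over m, n < 0 when p < 0. The difference of
    indicators encodes both cases and is 0 when m and n have opposite signs. *)
Lemma diff_kernel_tensor (a : k) (f : laurent k) :
  exists g : kernel, [/\ in_klaurent2 g,
    diff_kernel a a * g = tensl f - tensr f &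
    forall n m, g n m = f (m + n + 1) * ((0 <= m)%R%:R - (n < 0)%R%:R)].
Proof.
have [N fN] := laurent_bound f.
have [|g Mg gE] := @klaurent2_of k (Num.min N 0)
    (fun n m => f (m + n + 1) * ((0 <= m)%R%:R - (n < 0)%R%:R)).
  move=> m n mn; have [m0|m0] := leP 0 m; have [n0|n0] := ltP n 0.
  - by rewrite subrr mulr0.
  - by move: mn; rewrite !lt_min; lia.
  - by rewrite fN ?mul0r //; move: mn; rewrite !lt_min; lia.
  - by rewrite subrr mulr0.
exists g; split => //; apply: kernelP => n m.
rewrite diff_kernelME subrr mul0r add0r !gE laurentBE tenslE tensrE /=.
rewrite (_ : m - 1 + n + 1 = m + n); last by lia.
rewrite (_ : m + (n - 1) + 1 = m + n); last by lia.
rewrite -mulrBr (_ : (0 <= m - 1) = (0 <= m) && (m != 0)); last by lia.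
rewrite (_ : (n - 1 < 0) = (n < 0) || (n == 0)); last by lia.
by have [->|n0] := eqVneq n 0; have [->|m0] := eqVneq m 0;
  rewrite ?addr0 ?add0r ?lexx ?ltxx /= ?andbT ?orbF; ring.
Qed.

(** The geometric expansion of 1 / (z - w) in powers of w; its z-exponents are unbounded below, so
    it lies in C((z))((w)) but not in C((z, w)). *)
Lemma diff_kernel_inv (a : k) :
  exists2 u : kernel, diff_kernel a a * u = 1 &
    forall n m, u n m = ((0 <= n) && (m == - n - 1))%R%:R.
Proof.
have u0 n : n < 0 -> (if 0 <= n then lmono (- n - 1) else 0) = 0 :> laurent k.
  by move=> n0; rewrite leNgt n0.
pose u := Laurent (@bounded_below_int _ _ 0 u0).
have uE n m : u n m = ((0 <= n) && (m == - n - 1))%R%:R by rewrite /=; case: ifP.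
exists u => //; apply: kernelP => n m.
rewrite diff_kernelME subrr mul0r add0r !uE kernel1E.
rewrite (_ : (m - 1 == - n - 1) = (m == - n)); last by lia.
rewrite (_ : m == - (n - 1) - 1 = (m == - n)); last by lia.
rewrite (_ : (0 <= n - 1) = (0 <= n) && (n != 0)); last by lia.
have [->|n0] := eqVneq n 0; first by rewrite oppr0 subr0.
by rewrite andbT subrr.
Qed.

(* Since the diagonal sums of an antisymmetric kernel cancel in pairs, the
   coefficients of the quotient by [z - w] are truncated diagonal sums. *)
Lemma diff_kernel_antisym (a : k) (F : kernel) : in_klaurent2 F ->
  (forall n m, F n m = - F m n) -> (forall n, F n n = 0) ->
  exists2 H : kernel, in_klaurent2 H & diff_kernel a a * H = F.
Proof.
move=> [N FN] Fanti F0.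
(* Sum of [F] over total degree [d] and z-exponent at most [p]; it can start at [N], below which [F]
   vanishes. *)
pose T (d p : int) := if p < N then 0 else
  \sum_(j < (absz (p - N)).+1) F (d - (N + j%:Z)) (N + j%:Z).
have TS d p : T d p = T d (p - 1) + F (d - p) p.
  rewrite /T; have [pN|Np] := ltP p N.
    by rewrite ifT ?FN ?addr0 //; [left | lia].
  rewrite big_ord_recr /= gez0_abs ?subr_ge0 // subrKC.
  congr (_ + _); case: ifP => pN.
    by rewrite (_ : p - N = 0) ?big_ord0 //; lia.
  by rewrite (_ : (absz (p - 1 - N)%R).+1 = absz (p - N)%R) //; lia.
have [|H MH HE] := @klaurent2_of k N (fun n m => - T (m + n + 1) (Num.min m n)).
  by move=> m n mn; rewrite /T ifT ?oppr0 // gt_min; apply/orP.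
exists H => //; apply: kernelP => n m.
rewrite diff_kernelME subrr mul0r add0r !HE opprK.
rewrite (_ : m - 1 + n + 1 = m + n); last by lia.
rewrite (_ : m + (n - 1) + 1 = m + n); last by lia.
(* For [m < n] the recurrence [TS] yields [F n m] itself; for [n < m] it yields [- F m n], where
   antisymmetry enters; on the diagonal the two truncations coincide. *)
have [mn|nm|->] := ltgtP m n.
- rewrite !min_l; [|lia..].
  by rewrite [T _ m]TS addrC addrAC subrr add0r addrC addKr.
- rewrite !min_r; [|lia..].
  by rewrite [T _ n]TS opprD addrC addrA subrr add0r addrK -Fanti.
- by rewrite min_l ?min_r ?addNr ?F0 //; lia.
Qed.

(** With d = a - b, this expands 1 / (d + z - w) as the sum over p of (w - z)^p / d^(p+1). No
    negative powers occur, and the recurrence for the coefficients is Pascal's rule. *)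
Lemma diff_kernel_unit (a b : k) : a != b ->
  exists2 u : kernel, in_klaurent2 u & diff_kernel a b * u = 1.
Proof.
move=> ab; set d := a - b; have d0 : d != 0 by rewrite subr_eq0.
pose U (n m : int) : k := if (0 <= m) && (0 <= n) then
  (-1) ^+ absz m * 'C(absz m + absz n, absz m)%:R / d ^+ (absz m + absz n).+1 else 0.
have [|u Mu uE] := @klaurent2_of k 0 U.
  by move=> m n mn; rewrite /U ifF //; lia.
exists u => //; apply: kernelP => n m.
have U0 i j : (j < 0) || (i < 0) -> U i j = 0 by rewrite /U => ij; rewrite ifF //; lia.
have UE (i j : nat) :
    U i%:Z j%:Z = (-1) ^+ j * 'C(j + i, j)%:R * d^-1 ^+ (j + i).+1.
  by rewrite /U /= exprVn.
have subS (i : nat) : i.+1%:Z - 1 = i%:Z by lia.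
rewrite diff_kernelME -/d !uE kernel1E.
case: n => [n|n]; last by rewrite !U0 ?mulr0 ?addr0 ?subr0 //; lia.
case: m => [m|m]; last by rewrite !U0 ?mulr0 ?addr0 ?subr0 ?andbF //; lia.
case: n m => [|n] [|m].
- rewrite (U0 _ (0 - 1)) // (U0 (0 - 1)) // addr0 subr0 UE /= bin0.
  by rewrite expr0 expr1 !mul1r mulfV.
- rewrite subS (U0 (0 - 1)) // subr0 !UE !addn0 !binn !mulr1 /= exprS.
  by rewrite [d^-1 ^+ _.+2]exprS; move: (_ ^+ m.+1) (_ ^+ m) => x y; field.
- rewrite subS (U0 _ (0 - 1)) // addr0 !UE !add0n !bin0 !mulr1 /= !expr0 !mul1r.
  by rewrite [d^-1 ^+ _.+2]exprS mulrA mulfV // mul1r subrr.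
- rewrite !subS !UE !addSn !addnS binS natrD [(-1) ^+ m.+1]exprS [d^-1 ^+ _.+3]exprS.
  move: (d^-1 ^+ _) (_ ^+ m) => x y.
  by move: (binomial _ m.+1) (binomial _ m) => p q /=; field.
Qed.
End DiagonalDivision.

(** * Coefficients of the Green kernel *)

Section GreenKernel.
Context {k : fieldType} {S : finType} (h : S -> laurent k).
Notation K := {ffun S -> laurent k}.
Notation kernel := (laurent (laurent k)).
Implicit Types (f g u v : K) (V : set K).

Lemma respairingC f g : respairing h f g = respairing h g f.
Proof. by apply: eq_bigr => s _; rewrite [f s * _]mulrC. Qed.
Lemma respairingDr f g u : respairing h f (g + u) = respairing h f g + respairing h f u.
Proof.
rewrite /respairing -big_split; apply: eq_bigr => s _.
by rewrite ffunE mulrDr mulrDl laurentDE.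
Qed.
Lemma respairingZr c f g : respairing h f (c *: g) = c * respairing h f g.
Proof.
rewrite /respairing mulr_sumr; apply: eq_bigr => s _.
by rewrite ffunE lscaleMr lscaleMl laurentZE.
Qed.
Lemma respairing0r f : respairing h f 0 = 0.
Proof. by rewrite -(scale0r 0) respairingZr mul0r. Qed.
Lemma respairingBr f g u : respairing h f (g - u) = respairing h f g - respairing h f u.
Proof. by rewrite respairingDr -scaleN1r respairingZr mulN1r. Qed.
Lemma respairingDl f g u : respairing h (f + g) u = respairing h f u + respairing h g u.
Proof. by rewrite respairingC respairingDr ![respairing h u _]respairingC. Qed.
Lemma respairingZl c f g : respairing h (c *: f) g = c * respairing h f g.
Proof. by rewrite respairingC respairingZr respairingC. Qed.
Lemma respairing_sumr I (r : seq I) (F : I -> K) f :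
  respairing h f (\sum_(i <- r) F i) = \sum_(i <- r) respairing h f (F i).
Proof. exact: (big_morph _ (respairingDr f) (respairing0r f)). Qed.
Lemma respairing_suml I (r : seq I) (F : I -> K) f :
  respairing h (\sum_(i <- r) F i) f = \sum_(i <- r) respairing h (F i) f.
Proof. by rewrite respairingC respairing_sumr; under eq_bigr do rewrite respairingC. Qed.

Lemma adic_cvg_coef (c : nat -> k) (b : nat -> K) v (N : int) :
  adic_cvg (fun m => \sum_(j < m) c j *: b j) v ->
  exists m0 : nat, forall m, (m0 <= m)%N -> forall s n, n < N ->
    v s n = \sum_(j < m) c j * b j s n.
Proof.
move=> cv; have [m0 m0P] := cv N; exists m0 => m m0m s n nN.
have := m0P m m0m s n nN; rewrite !ffunE laurentBE => /eqP.
rewrite subr_eq0 => /eqP ->; rewrite sum_ffunE laurent_sumE.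
by apply: eq_bigr => j _; rewrite ffunE laurentZE.
Qed.

Lemma ffun_bound f : exists N : int, forall s n, n < N -> f s n = 0.
Proof.
have /choice[N NP] s := laurent_bound (f s).
exists (- (\max_s absz (N s))%:Z) => s n nN; apply: NP.
by have := @leq_bigmax _ (fun s => absz (N s)) s; lia.
Qed.

(** Continuity of the pairing in its second argument, which allows pairing with an adically
    convergent series term by term. *)
Lemma respairing_vanish u : exists N : int, forall f,
  (forall s n, n < N -> f s n = 0) -> respairing h u f = 0.
Proof.
have [a ua] := ffun_bound u.
have [b hb] := ffun_bound [ffun s => h s].
exists (- a - b) => f fN; rewrite /respairing big1 // => s _.
apply: (@laurentM_vanish _ (a + (- a - b)) b) => [n nab|n nb|]; last by lia.
- by apply: (@laurentM_vanish _ a (- a - b)) => // i; [exact: ua | exact: fN].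
- by have := hb s n nb; rewrite ffunE.
Qed.

(** Otherwise adjoining the line through [u] would enlarge [V] while keeping it isotropic. *)
Lemma maximal_isotropic_mem V u : maximal_isotropic h V ->
  respairing h u u = 0 -> (forall v, V v -> respairing h u v = 0) -> V u.
Proof.
move=> [[V0 Vlin] Viso Vmax] uu uV.
pose W : set K := [set w | exists c v, V v /\ w = c *: u + v].
have Vadd v w : V v -> V w -> V (v + w).
  by move=> Vv Vw; rewrite -[v]scale1r; apply: Vlin.
have Wlin : linear_subspace W.
  split; first by exists 0, 0; rewrite scale0r addr0.
  move=> c _ _ [a [v [Vv ->]]] [b [w [Vw ->]]].
  exists (c * a + b), (c *: v + w); split; first exact: Vlin.
  by rewrite scalerDr scalerDl scalerA addrACA.
have Wiso : isotropic h W.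
  move=> _ _ [a [v [Vv ->]]] [b [w [Vw ->]]].
  rewrite respairingDl !respairingDr !respairingZl !respairingZr uu.
  by rewrite uV // respairingC uV // Viso // !mulr0 !addr0.
have VW : V `<=` W by move=> v Vv; exists 0, v; rewrite scale0r add0r.
by rewrite -(Vmax W) //; exists 1, 0; rewrite scale1r addr0.
Qed.

(** If [h s] vanished, the indicator of [s] would pair to zero with everything, hence lie in both
    maximal isotropic subspaces, which meet only in 0. *)
Lemma complementary_isotropic_neq0 V W s : maximal_isotropic h V ->
  maximal_isotropic h W -> complementary V W -> h s != 0.
Proof.
move=> maxV maxW [VW _]; apply/eqP => hs0.
pose u : K := [ffun s' => (s' == s)%:R].
have u0 v : respairing h u v = 0.
  rewrite /respairing big1 // => s' _; rewrite ffunE.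
  by have [->|_] := eqVneq s' s; rewrite ?hs0 ?mulr0 ?mul0r.
have /(congr1 (fun f : K => f s)) : u = 0.
  have : (V `&` W) u by split; apply: maximal_isotropic_mem.
  by rewrite VW.
by rewrite !ffunE eqxx => /eqP; rewrite oner_eq0.
Qed.

(** The element z_s^(-m-1) / h_s supported at [s]: pairing with it extracts the coefficient of
    z_s^m. *)
Definition eps (s : S) (m : int) : K :=
  [ffun s' => if s' == s then lmono (- m - 1) / h s else 0].

Lemma epsE s m t n : eps s m t n = if t == s then (h s)^-1 (n + m + 1) else 0.
Proof.
by rewrite ffunE; case: eqP => // _; rewrite lmonoME opprB opprK (addrC 1) addrA.
Qed.

Lemma respairing_eps u s m : h s != 0 -> respairing h u (eps s m) = u s m.
Proof.
move=> hs0; rewrite /respairing (bigD1 s) // big1 => [|s' s's]; last first.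
  by rewrite [eps s m s']ffunE (negbTE s's) mulr0 mul0r.
rewrite ffunE eqxx -mulrA divrK ?laurent_field_unit // mulrC lmonoME.
by rewrite opprB opprK addKr; exact: addr0.
Qed.

Section DualBases.
Variables (Rg Lambda : set K) (e' e : nat -> K).
Hypotheses (maxR : maximal_isotropic h Rg) (maxL : maximal_isotropic h Lambda).
Hypothesis compl : complementary Rg Lambda.
Hypotheses (Re' : forall j, Rg (e' j)) (be : is_adic_basis Lambda e).
Hypotheses (dual : dual_families h e' e) (e0 : adic_cvg e 0).

Let h0 s : h s != 0. Proof. exact: complementary_isotropic_neq0 compl. Qed.

Lemma adic_cvg0_tail (N : int) : exists M : nat, forall j, (M <= j)%N ->
  forall s n, n < N -> e j s n = 0.
Proof.
have [M MP] := e0 N; exists M => j Mj s n nN.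
have := MP j Mj s n nN; rewrite !ffunE sub0r laurentNE => /eqP.
by rewrite oppr_eq0 => /eqP.
Qed.

Lemma adic_cvg0_bound : exists N : int, forall j s n, n < N -> e j s n = 0.
Proof.
have [M MP] := adic_cvg0_tail 0.
have /choice[N NP] j := ffun_bound (e j).
exists (- (\max_(j < M) absz (N j))%:Z) => j s n nN.
have [Mj|jM] := leqP M j; first by apply: MP => //; lia.
apply: NP; have jmax : (absz (N j) <= \max_(i < M) absz (N i))%N.
  exact: (@leq_bigmax _ (fun i : 'I_M => absz (N i)) (Ordinal jM)).
by lia.
Qed.

Lemma Lambda_bound : exists N : int, forall v, Lambda v -> forall s n, n < N -> v s n = 0.
Proof.
have [N eN] := adic_cvg0_bound; exists N => v Lv s n nN.
have [c [cv _]] := be.2 v Lv; have [m0 m0P] := adic_cvg_coef N cv.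
by rewrite (m0P m0) // big1 // => j _; rewrite eN ?mulr0.
Qed.

(** For [m] very negative [eps s m] has high order, hence is orthogonal to itself and to [Lambda],
    whose elements have uniformly bounded poles; maximality does the rest. *)
Lemma eps_Lambda s : exists N : int, forall m, m < N -> Lambda (eps s m).
Proof.
have [N LN] := Lambda_bound; have [b hb] := laurent_bound (h s)^-1.
exists (Num.min N (Num.min 0 b)) => m; rewrite !lt_min => /and3P[mN m0 mb].
apply: (maximal_isotropic_mem maxL) => [|v Lv].
  by rewrite respairing_eps // epsE eqxx hb //; lia.
by rewrite respairingC respairing_eps // LN.
Qed.

Lemma dual_coef v (c : nat -> k) (i : nat) :
  adic_cvg (fun m => \sum_(j < m) c j *: e j) v ->
  respairing h (e' i) v = - c i.
Proof.
move=> cv; have [N NP] := respairing_vanish (e' i).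
have [m0 m0P] := cv N; pose m := maxn m0 i.+1.
have := NP _ (m0P m (leq_maxl _ _)); rewrite respairingBr => /eqP.
rewrite subr_eq0 => /eqP ->; rewrite respairing_sumr.
have im : (i < m)%N by rewrite leq_max leqnn orbT.
rewrite (bigD1 (Ordinal im)) //= big1 ?addr0 => [|j ji].
  by rewrite respairingZr dual eqxx mulrN1.
rewrite respairingZr dual eq_sym; case: eqP => [ij|_]; last by rewrite oppr0 mulr0.
by case/eqP: ji; apply: val_inj.
Qed.

Lemma greenE s t n (M : nat) : (forall j, (M <= j)%N -> e j t n = 0) ->
  green e' e s t n = \sum_(j < M) e j t n *: e' j s.
Proof.
move=> MP; rewrite /green laurent_ofE; last first.
  have [N eN] := adic_cvg0_bound; apply: (@bounded_below_int _ _ N) => i iN.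
  by rewrite fsbig1 // => j _; rewrite eN // scale0r.
rewrite (fsbigE (iota 0 M)) ?iota_uniq //.
  have -> : iota 0 M = index_iota 0 M by rewrite /index_iota subn0.
  by rewrite big_mkord; apply: eq_bigl => j; rewrite in_setT.
move=> j _; rewrite mem_iota add0n -leqNgt /= => Mj.
by rewrite MP // scale0r.
Qed.

(* That is, [G] is the kernel of minus the projection of [K] onto [Lambda] along
   [Rg]. *)
Lemma green_coef s t n m a b : Rg a -> Lambda b -> eps s m = a + b ->
  green e' e s t n m = - b t n.
Proof.
move=> Ra Lb ab.
have [M MP] := adic_cvg0_tail (n + 1).
have eM j : (M <= j)%N -> e j t n = 0 by move=> Mj; apply: MP => //; lia.
rewrite (greenE _ eM).
pose G : K := \sum_(j < M) e j t n *: e' j.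
have -> : \sum_(j < M) e j t n *: e' j s = G s.
  by rewrite sum_ffunE; apply: eq_bigr => j _; rewrite ffunE.
have [c [cv _]] := be.2 b Lb.
(* The coefficient of z^m is read off by pairing with [eps s m]; its component [a] in [Rg]
   contributes nothing, since [Rg] is isotropic. *)
rewrite -(respairing_eps G m (h0 s)) ab respairingDr !respairing_suml.
rewrite big1 ?add0r; last first.
  by move=> j _; rewrite respairingZl; case: maxR => _ iso _; rewrite iso ?mulr0.
under eq_bigr => j _ do rewrite respairingZl (dual_coef _ cv) mulrN.
rewrite sumrN; congr (- _).
have [m0 m0P] := adic_cvg_coef (n + 1) cv.
pose m1 := maxn m0 M.
rewrite (m0P m1) ?leq_maxl //; last by lia.
rewrite -[m1](subnKC (leq_maxr m0 M)) big_split_ord /=.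
rewrite [X in _ = _ + X]big1 ?addr0 => [|j _]; last by rewrite eM ?mulr0 // leq_addr.
by apply: eq_bigr => j _; rewrite mulrC.
Qed.

(** Split [eps s m] and [eps t n] along [Rg] and [Lambda]. Isotropy reduces their pairing to the two
    cross terms, which are the two coefficients of the kernel up to sign; the right-hand side is
    minus a coefficient of the delta function of the pairing. *)
Lemma green_antisym s t n m : green e' e s t n m + green e' e t s m n =
  - (if s == t then (h s)^-1 (n + m + 1) else 0).
Proof.
have [a [b [Ra Lb ab]]] := compl.2 (eps s m).
have [a' [b' [Ra' Lb' ab']]] := compl.2 (eps t n).
rewrite (green_coef _ _ Ra Lb ab) (green_coef _ _ Ra' Lb' ab') -opprD; congr (- _).
rewrite eq_sym -epsE -(respairing_eps _ _ (h0 t)) -[RHS](respairing_eps _ _ (h0 t)).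
rewrite -[b' s m](respairing_eps _ _ (h0 s)) ab ab'.
case: maxR maxL => _ isoR _ [_ isoL _].
rewrite !(respairingDl, respairingDr) (isoR a a') // (isoL b b') // (isoL b' b) //.
by rewrite (respairingC b' a) !addr0 add0r addrC.
Qed.

(** For such [m] the element [eps s m] is already in [Lambda], so its projection is itself. *)
Lemma green_coef_small s t : exists N : int, forall m n, m < N ->
  green e' e s t n m = - (if t == s then (h s)^-1 (n + m + 1) else 0).
Proof.
have [N NP] := eps_Lambda s; exists N => m n mN.
rewrite -epsE; apply: (@green_coef s t n m 0 (eps s m)); rewrite ?add0r //.
  by case: maxR => -[].
exact: NP.
Qed.

End DualBases.
End GreenKernel.

(* Writing [u = 1 / pi] and [G = r - v u], the double poles of [dz G] and [G ^ 2]
   cancel; the simple pole has coefficient [2 v r - dz v = v a + (v g - dz v)] and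
   [v g - dz v = - pi (dz g)] by differentiating [pi g = v - vw]. *)
Lemma riccati_pole_cancel (Q : comNzRingType) (d : Q -> Q)
    (pi u v vw g r a a1 G : Q) : derivation d ->
  pi * u = 1 -> d pi = v -> d vw = 0 ->
  G = r - v * u -> pi * g = v - vw -> r + r = g + a -> pi * a1 = a ->
  d G - G ^+ 2 = d r - r ^+ 2 + v * a1 - d g.
Proof.
move=> derd piu dpi dvw -> pig r2 pia.
have du : d u = - (v * u ^+ 2).
  have : d (pi * u) = 0 by rewrite piu (der1 derd).
  rewrite (derM derd) dpi => E.
  have -> : d u = u * (v * u + pi * d u) - v * u ^+ 2 + (1 - pi * u) * d u by ring.
  by rewrite E piu mulr0 subrr mul0r addr0 sub0r.
have dv : d v = v * g + pi * d g.
  by rewrite -dpi -(derM derd) pig (derB derd) dvw subr0 dpi.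
have a1E : a1 = u * (r + r - g).
  have -> : r + r - g = a by rewrite r2 addrC addKr.
  by rewrite -pia mulrA [u * pi]mulrC piu mul1r.
rewrite (derB derd) (derM derd) du dv a1E.
by rewrite -[d g in RHS]mul1r -piu; ring.
Qed.

(** * Regularity of the Green kernel and of gamma at pairs of points *)

Section Local.
Context {k : fieldType} {S : finType} (h : S -> laurent k) (c : S -> k).
Hypothesis char0 : forall n, n.+1%:R != 0 :> k.
Notation K := {ffun S -> laurent k}.
Notation kernel := (laurent (laurent k)).
Variables (Rg Lambda : set K) (e' e : nat -> K).
Hypotheses (maxR : maximal_isotropic h Rg) (maxL : maximal_isotropic h Lambda).
Hypothesis compl : complementary Rg Lambda.
Hypotheses (Re' : forall j, Rg (e' j)) (be : is_adic_basis Lambda e).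
Hypotheses (dual : dual_families h e' e) (e0 : adic_cvg e 0).

Let G s t := green e' e s t.
Let v s := (h s)^-1.
Let z : K := [ffun s => lC (c s) + lvar k].

Lemma derl_coord s : derl h s (tensl (z s)) = tensl (v s).
Proof. by rewrite derl_tensl ffunE lderivD lderivC lderiv_var add0r mul1r. Qed.

Lemma derr_coord t : derr (v t) (tensr (z t)) = tensr (v t).
Proof. by rewrite derr_tensr ffunE lderivD lderivC lderiv_var add0r mul1r. Qed.

Lemma coord_diff s t : tensl (z s) - tensr (z t) = diff_kernel (c s) (c t).
Proof. by rewrite /diff_kernel !ffunE. Qed.

Lemma klaurent2_green s t : s != t -> in_klaurent2 (G s t).
Proof.
move=> st; apply/klaurent2P.
have [N NP] := green_coef_small maxR maxL compl Re' be dual e0 s t.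
by exists N => m n mN; rewrite NP // eq_sym (negbTE st) oppr0.
Qed.

Lemma derl_diff s t : derl h s (diff_kernel (c s) (c t)) = tensl (v s).
Proof.
rewrite -coord_diff (derB (derl_derivation h s)) derl_coord derl_tensr.
by rewrite subr0.
Qed.

(** Here [r] is [G] freed from its polar part, and [g] is the divided difference of [v].
    Antisymmetry of [G] makes [r] plus its transpose equal to [g], so [r + r - g] is antisymmetric
    and divisible by z - w; [riccati_pole_cancel] then expresses gamma through elements of C((z,
    w)). *)
Lemma green_regular_diag s : exists r g : kernel, [/\ in_klaurent2 r, in_klaurent2 g,
  in_klaurent2 (gamma_kernel h e' e s s),
  diff_kernel (c s) (c s) * r = diff_kernel (c s) (c s) * G s s + tensl (v s) &
  diff_kernel (c s) (c s) * g = tensl (v s) - tensr (v s)].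
Proof.
set pi := diff_kernel (c s) (c s).
have [g [Mg pig gE]] := diff_kernel_tensor (c s) (v s).
have [u piu uE] := diff_kernel_inv (c s).
pose r := G s s + tensl (v s) * u.
have rE n m : r n m = G s s n m + v s (m + n + 1) * (0 <= n)%R%:R.
  rewrite laurentDE; congr (_ + _).
  have -> : (tensl (v s) * u) n = v s * u n by exact: lCME.
  have -> : u n = (0 <= n)%R%:R *: lmono (- n - 1).
    apply: laurentP => i; rewrite uE laurentZE /=.
    by case: (0 <= n); rewrite ?mul1r ?mul0r.
  by rewrite lscaleMr laurentZE mulrC (mulrC (v s)) lmonoME opprB opprK (addrC 1) addrA.
have Mr : in_klaurent2 r.
  have [N NP] := green_coef_small maxR maxL compl Re' be dual e0 s s.
  have [b vb] := laurent_bound (v s).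
  apply/klaurent2P; exists (Num.min N b) => m n; rewrite lt_min => /andP[mN mb].
  rewrite rE NP // eqxx -/(v s) (addrC n).
  (* If [n >= 0], the added polar part cancels the explicit coefficient of [G]; if [n < 0], the
     exponent [m + n + 1] is below [b] and [v s] has no such term. *)
  have [n0|n0] := leP 0 n; first by rewrite mulr1 addNr.
  by rewrite vb ?mul0r ?oppr0 ?addr0 //; lia.
(* The delta function in [green_antisym] and the two polar parts add up to the weight -1 + [n >= 0]
   + [m >= 0] = [m >= 0] - [n < 0] found in [gE]. *)
have anti n m : r n m + r m n = g n m.
  rewrite !rE addrACA (green_antisym maxR maxL compl Re' be dual e0) eqxx -/(v s).
  rewrite gE (addrC n m); have -> : (n < 0)%R%:R = 1 - (0 <= n)%R%:R :> k.
    by rewrite ltNge; case: (0 <= n); rewrite ?subrr ?subr0.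
  by ring.
pose a := r + r - g.
have aE n m : a n m = r n m - r m n.
  have -> : a n m = r n m + r n m - g n m by [].
  by rewrite -anti opprD addrACA subrr add0r.
have Ma : in_klaurent2 a by apply: klaurent2B => //; exact: klaurent2D.
have [||a1 Ma1 pia] := diff_kernel_antisym (c s) Ma.
- by move=> n m; rewrite !aE opprB.
- by move=> n; rewrite aE subrr.
exists r, g; split => //; last first.
  by rewrite mulrDr mulrCA piu mulr1.
have derz := derl_derivation h s.
rewrite /gamma_kernel -/(G s s).
have GE : G s s = r - tensl (v s) * u by rewrite /r addrK.
have r2 : r + r = g + a by rewrite /a [RHS]addrC subrK.
have dvw := derl_tensr h s (v s).
rewrite (riccati_pole_cancel derz piu (derl_diff s s) dvw GE pig r2 pia).
apply: klaurent2B; last exact: klaurent2_derl.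
apply: klaurent2D; last exact: klaurent2M (klaurent2_tensl _) Ma1.
by apply: klaurent2B; [exact: klaurent2_derl | exact: klaurent2X].
Qed.

(** For different coordinate values z - w is invertible in C((z, w)), so off the diagonal [r] and
    [g] come from plain division, and gamma is regular because [G] is. *)
Lemma green_regular s t : s = t \/ c s <> c t ->
  exists r g : kernel, [/\ in_klaurent2 r, in_klaurent2 g,
  in_klaurent2 (gamma_kernel h e' e s t),
  diff_kernel (c s) (c t) * r = diff_kernel (c s) (c t) * G s t + tensl (v s) &
  diff_kernel (c s) (c t) * g = tensl (v s) - tensr (v t)].
Proof.
have [<- _|st [//|/eqP cst]] := eqVneq s t; first exact: green_regular_diag.
  by move=> est; rewrite est eqxx in st.
have [u Mu piu] := diff_kernel_unit cst.
have MG := klaurent2_green st.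
exists (G s t + tensl (v s) * u), (u * (tensl (v s) - tensr (v t))); split.
- by apply: klaurent2D MG _; apply: klaurent2M Mu; exact: klaurent2_tensl.
- by apply: klaurent2M Mu _; apply: klaurent2B;
    [exact: klaurent2_tensl | exact: klaurent2_tensr].
- by apply: klaurent2B; [exact: klaurent2_derl | exact: klaurent2X].
- by rewrite mulrDr mulrCA piu mulr1.
- by rewrite mulrA piu mul1r.
Qed.

Lemma kconst_natV n : exists2 x : kernel, in_klaurent2 x & x *+ n.+1 = 1.
Proof.
exists (kconst n.+1%:R^-1); first exact: klaurent2_kconst.
by rewrite -rmorphMn /= -mulr_natr mulVf // rmorph1.
Qed.

(** * Equations in hbar and the kernel identity *)

Variables (psi : fps {malg k[{cmonom nat}]}) (psiP : psi_solution psi).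

(** Substitution is a ring morphism that turns D into [\partial \otimes 1] by
    [subst_gam_derivation], so the equation defining [psi] carries over. *)
Lemma psi_gamma_ode s t (Psi := psi_gamma h e' e psi s t) :
  Psi 0%N = 0 /\ fps_deriv Psi =
    fps_map (derl h s) Psi - 1 - fpsC (gamma_kernel h e' e s t) * Psi ^+ 2.
Proof.
have [psi0 psiE] := psiP.
rewrite {}/Psi /psi_gamma; set g := fun j => iter j _ _.
split; first by rewrite /= psi0 rmorph0.
rewrite -fps_map_deriv psiE !fps_mapB fps_mapM.
rewrite fps_map_sqr.
congr (_ - _ - _ * _).
- apply: fpsP => n /=; rewrite -(subst_gam_derivation _ (derl_derivation h s)) //.
  exact: derl_kconst.
- by rewrite [LHS]fps_mapC rmorph1.
- by rewrite [LHS]fps_mapC; exact: (congr1 (@fpsC _) (subst_gam_gam g 0)).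
Qed.

(** On coefficients this is (n + 1) / (n + 1)! = 1 / n!, which uses characteristic zero. *)
Lemma qder_ode t : fps_deriv (fps_map (@tensr k) (qder h z t)) =
  - fps_map (derr (v t)) (fps_map (@tensr k) (qder h z t)).
Proof.
apply: fpsP => n; rewrite fpsNE /= derr_tensr -tensrMn -tensrN; congr tensr.
rewrite ffunE; set f := fun_of_fin (iter n _ _) t; apply: laurentP => i.
rewrite laurentMnE laurentZE laurentNE.
have -> : lderiv (((-1) ^+ n / n`!%:R) *: f) = ((-1) ^+ n / n`!%:R) *: lderiv f.
  by rewrite !lCZ lderivM lderivC mul0r add0r.
rewrite lscaleMl laurentZE -mulNr -/(v t) -mulrnAl; congr (_ * _).
have fact0 : n`!%:R != 0 :> k by rewrite -(prednK (fact_gt0 n)) char0.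
rewrite exprS factS natrM -mulr_natr; move: (char0 n) fact0.
move: (n.+1%:R) (n`!%:R) ((-1) ^+ n) => x y w x0 y0; field.
by rewrite x0 y0.
Qed.

Theorem green_kernel_shift : exists i : S -> S -> fps kernel,
  (forall s t, i s t 0%N = 1 /\ forall n, in_klaurent2 (i s t n)) /\
  forall s t, s = t \/ c s <> c t ->
    fpsC (tensl (z s)) - fps_map (@tensr k) (qder h z t) =
    i s t * (fpsC (tensl (z s) - tensr (z t)) +
      fpsC ((tensl (z s) - tensr (z t)) * green e' e s t) * psi_gamma h e' e psi s t).
Proof.
suff H s t : exists i : fps kernel,
    [/\ i 0%N = 1, forall n, in_klaurent2 (i n) &
    s = t \/ c s <> c t ->
    fpsC (tensl (z s)) - fps_map (@tensr k) (qder h z t) =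
    i * (fpsC (tensl (z s) - tensr (z t)) +
      fpsC ((tensl (z s) - tensr (z t)) * green e' e s t) * psi_gamma h e' e psi s t)].
  have /choice[i iP] st := H st.1 st.2.
  exists (fun s t => i (s, t)); split=> s t; have [i0 Mi iE] := iP (s, t); last exact: iE.
  by split.
(* No identity is claimed at a pair that is not admissible, and the constant series 1 serves as
   default there. *)
have [adm|nadm] := pselect (s = t \/ c s <> c t); last first.
  exists 1; split => // n; case: n => [|n]; first exact: klaurent2_1.
  rewrite -[fcoef _ _]/(0 : kernel) -(subrr 1).
  exact: klaurent2B klaurent2_1 klaurent2_1.
have [r [g [Mr Mg Mgamma rE gE]]] := green_regular adm.
have [Psi0 PsiE] := psi_gamma_ode s t.
have derz := derl_derivation h s.
have derw := derr_derivation (v t).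
have Mdz := @klaurent2_derl k S h s.
have Mdw := @klaurent2_derr k (v t).
have U0 : fps_map (@tensr k) (qder h z t) 0%N = tensr (z t).
  by rewrite /= fact0 expr0 divr1 scale1r.
have dzU : fps_map (derl h s) (fps_map (@tensr k) (qder h z t)) = 0.
  by apply: fpsP => n; exact: derl_tensr.
have MPsi n : in_klaurent2 (psi_gamma h e' e psi s t n).
  apply: klaurent2_subst_gam => j; elim: j => // j; exact: Mdz.
have hG : derl h s (G s t) = gamma_kernel h e' e s t + G s t ^+ 2.
  by rewrite /gamma_kernel subrK.
move: rE gE; rewrite -coord_diff -(derr_coord t) => rE gE.
have [i [i0 Mi iE]] := kernel_ode klaurent2_1 klaurent2B klaurent2M kconst_natV derz derw
  Mdz Mdw (derl_coord s) (derr_tensl _ _) (derr_tensl _ _) U0 (qder_ode t) dzU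
  Mr Mg Mgamma MPsi rE gE hG Psi0 PsiE.
by exists i.
Qed.
End Local.

Theorem proposition1p12
  (R : realType) (X : topologicalType) (XC : complex_curve R X)
  (hX_hausdorff : hausdorff_space X) (hX_compact : compact [set: X])
  (hX_connected : connected [set: X])
  (om : mero_differential XC) (hom : nonzero_differential om)
  (S : {fset X}) (hS : forall p, zero_or_pole om p -> p \in S)
  (z : S -> chart R X) (hz : forall s : S, local_coordinate XC (val s) (z s))
  (h : S -> laurent R[i])
  (hh : forall s : S, differential_expansion om (z s) (val s) (h s))
  (hR : maximal_isotropic h (regular_functions XC z))
  (Lambda : set {ffun S -> laurent R[i]})
  (hLambda : maximal_isotropic h Lambda)
  (hcompl : complementary (regular_functions XC z) Lambda)
  (hcomm : commensurable Lambda (@integers R[i] S))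
  (e' e : nat -> {ffun S -> laurent R[i]})
  (he' : is_basis (regular_functions XC z) e')
  (he : is_adic_basis Lambda e)
  (hdual : dual_families h e' e)
  (he0 : adic_cvg e 0)
  (psi : fps {malg R[i][{cmonom nat}]}) (hpsi : psi_solution psi) :
  exists i : S -> S -> fps (laurent (laurent R[i])),
    (forall s t, i s t 0%N = 1 /\ forall n, in_klaurent2 (i s t n)) /\
    forall s t, admissible_pair z s t ->
      let zs := tensl (coordinate_element z s) in
      let wt := tensr (coordinate_element z t) in
      fpsC zs - fps_map (@tensr R[i]) (qder h (coordinate_element z) t) =
      i s t * (fpsC (zs - wt) +
               fpsC ((zs - wt) * green e' e s t) * psi_gamma h e' e psi s t).
Proof.
have char0 n : n.+1%:R != 0 :> R[i] by rewrite pnatr_eq0.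
have [Re' _ _] := he'.
(* With [c] the coordinate values, the local element [z] becomes [coordinate_element z] and the side
   condition becomes [admissible_pair]. *)
exact: (green_kernel_shift (coordinate_value z) char0 hR hLambda hcompl Re'
  he hdual he0 hpsi).
Qed.
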